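(* Let $q\ge1$ be an integer with prime factorization $q=\prod_p p^{e_p}$. Then: (i) the natural reduction map gives an isomorphism $\Gamma(\mathrm{mod}\ q)\cong\prod_p\Gamma(\mathrm{mod}\ p^{e_p})$; (ii) with $q'=\gcd(q,12)$, one has $\Gamma(q')/\Gamma(q)=G(q')/G(q)$, i.e. the image of $\Gamma(q')$ in $G(\mathrm{mod}\ q)$ equals the image of $G(q')$ in $G(\mathrm{mod}\ q)$; (iii) $\Gamma(\mathrm{mod}\ 12)$ is a subgroup of $G(\mathrm{mod}\ 12)$ of index $72$.
   Context: Let $\phi=\frac{1+\sqrt5}{2}$, and let $\Gamma\subset \mathrm{SL}_2(\mathbb Z[\phi])$ be the group generated by $A=\begin{pmatrix}1&\phi\\0&1\end{pmatrix}$, $B=\begin{pmatrix}1&0\\\phi&1\end{pmatrix}$, $C=\begin{pmatrix}\phi&\phi\\1&\phi\end{pmatrix}$, $D=\begin{pmatrix}\phi&1\\\phi&\phi\end{pmatrix}$. Let $G=\mathrm{SL}_2(\mathbb Z[\phi])$. For an integer $q\ge1$, let $\pi_q:G\to\mathrm{SL}_2(\mathbb Z[\phi]/q\mathbb Z[\phi])$ be reduction mod $q$; write $G(\mathrm{mod}\ q)=\pi_q(G)$, $\Gamma(\mathrm{mod}\ q)=\pi_q(\Gamma)$, $G(q)=\ker\pi_q$, and $\Gamma(q)=\Gamma\cap\ker\pi_q$. For $q'\mid q$, $\Gamma(q')/\Gamma(q)$ and $G(q')/G(q)$ denote the images $\pi_q(\Gamma(q'))$ and $\pi_q(G(q'))$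 in $G(\mathrm{mod}\ q)$. *)

(* Defs.v *)
From HB Require Import structures.
From mathcomp Require Import all_boot all_order all_algebra all_fingroup all_field.
From mathcomp Require Import ring_quotient generic_quotient.
From mathcomp Require Import boolp ring.

Set Implicit Arguments.
Unset Strict Implicit.
Unset Printing Implicit Defensive.

Import Order.TTheory GRing.Theory Num.Theory.

Local Open Scope ring_scope.

(* SL_2 over a possibly trivial commutative ring: Z[phi]/q is trivial for
   q = 1, hence comPzRingType rather than comNzRingType. *)
Section SL2.
Variable R : comPzRingType.

Record SL2 := MkSL2 { SL2val :> 'M[R]_2; _ : \det SL2val == 1 }.

HB.instance Definition _ := [isSub for SL2val].
HB.instance Definition _ := [Choice of SL2 by <:].

Lemma SL2det (g : SL2) : \det g = 1.
Proof. by case: g => M /= /eqP. Qed.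

Fact SL2_one_subproof : \det (1%:M : 'M[R]_2) == 1.
Proof. by rewrite det1. Qed.
Fact SL2_mul_subproof (g h : SL2) : \det (g *m h) == 1.
Proof. by rewrite det_mulmx !SL2det mulr1. Qed.
Fact SL2_adjK (g : SL2) : \adj g *m g = 1%:M.
Proof. by rewrite mul_adj_mx SL2det. Qed.
Fact SL2_inv_subproof (g : SL2) : \det (\adj g) == 1.
Proof.
by have := congr1 determinant (SL2_adjK g); rewrite det_mulmx SL2det mulr1 det1 => ->.
Qed.

Definition SL2_one := MkSL2 SL2_one_subproof.
Definition SL2_mul g h := MkSL2 (SL2_mul_subproof g h).
Definition SL2_inv g := MkSL2 (SL2_inv_subproof g).

Fact SL2_mulA : associative SL2_mul.
Proof. by move=> x y z; apply: val_inj; apply: mulmxA. Qed.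
Fact SL2_mul1 : left_id SL2_one SL2_mul.
Proof. by move=> x; apply: val_inj; apply: mul1mx. Qed.
Fact SL2_mulr1 : right_id SL2_one SL2_mul.
Proof. by move=> x; apply: val_inj; apply: mulmx1. Qed.
Fact SL2_mulV : left_inverse SL2_one SL2_inv SL2_mul.
Proof. by move=> x; apply: val_inj; apply: SL2_adjK. Qed.
Fact SL2_mulrV : right_inverse SL2_one SL2_inv SL2_mul.
Proof. by move=> x; apply: val_inj; rewrite /= mul_mx_adj SL2det. Qed.

HB.instance Definition _ :=
  isGroup.Build SL2 SL2_mulA SL2_mul1 SL2_mulr1 SL2_mulV SL2_mulrV.

Lemma val_SL2M (g h : SL2) : SL2val (g * h)%g = g *m h. Proof. by []. Qed.
Lemma val_SL2V (g : SL2) : SL2val g^-1%g = \adj g. Proof. by []. Qed.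
Lemma val_SL21 : SL2val 1%g = 1%:M. Proof. by []. Qed.

Definition mx2 (a b c d : R) : 'M[R]_2 :=
  \matrix_(i, j) if i == 0 then (if j == 0 then a else b)
                 else (if j == 0 then c else d).

Fact det_mx2 (a b c d : R) : \det (mx2 a b c d) = a * d - b * c.
Proof.
rewrite (expand_det_row _ 0) !big_ord_recl big_ord0 /cofactor !det_mx11 !mxE /=.
by rewrite addr0 add0n expr0 expr1 mul1r mulN1r mulrN.
Qed.

Fact SL2_of_subproof (a b c d : R) :
  a * d - b * c = 1 -> \det (mx2 a b c d) == 1.
Proof. by rewrite det_mx2 => ->. Qed.

Definition SL2_of (a b c d : R) (adbc : a * d - b * c = 1) : SL2 :=
  MkSL2 (SL2_of_subproof adbc).
End SL2.

HB.instance Definition _ (R : finComPzRingType) := [Finite of SL2 R by <:].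

Section SL2Map.
Variables (R S : comPzRingType) (f : {rmorphism R -> S}).

Fact SL2_map_subproof (g : SL2 R) : \det (map_mx f g) == 1.
Proof. by rewrite det_map_mx SL2det rmorph1. Qed.

Definition SL2_map (g : SL2 R) : SL2 S := MkSL2 (SL2_map_subproof g).

Fact SL2_map_is_monoid_morphism : monoid.monoid_morphism SL2_map.
Proof.
by split=> [|x y]; apply: val_inj; rewrite /= ?map_mx1 ?map_mxM.
Qed.

HB.instance Definition _ :=
  isUMagmaMorphism.Build (SL2 R) (SL2 S) SL2_map SL2_map_is_monoid_morphism.
End SL2Map.

Definition phi : algC := (1 + sqrtC 5) / 2.

Lemma phi_sqr : phi ^+ 2 = phi + 1.
Proof.
have s5 : sqrtC 5 ^+ 2 = 5 :> algC by exact: sqrtCK.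
by rewrite /phi; field: s5.
Qed.

(* Z[phi] = { P(phi) | P in Z[X] } *)
Definition Zphi_pred : {pred algC} :=
  fun x => `[< exists P : {poly int}, x = (map_poly intr P).[phi] >].

Fact Zphi_subring : subring_closed Zphi_pred.
Proof.
split=> [|x y /asboolP[P ->] /asboolP[Q ->]|x y /asboolP[P ->] /asboolP[Q ->]].
- by apply/asboolP; exists 1; rewrite rmorph1 hornerC.
- by apply/asboolP; exists (P - Q); rewrite rmorphB hornerD hornerN.
- by apply/asboolP; exists (P * Q); rewrite rmorphM hornerM.
Qed.

HB.instance Definition _ :=
  GRing.isSubringClosed.Build algC Zphi_pred Zphi_subring.

Record Zphi := MkZphi { Zphi_val :> algC; _ : Zphi_val \in Zphi_pred }.

HB.instance Definition _ := [isSub for Zphi_val].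
HB.instance Definition _ := [Choice of Zphi by <:].
HB.instance Definition _ := [SubChoice_isSubComNzRing of Zphi by <:].

Fact phi_Zphi : phi \in Zphi_pred.
Proof. by apply/asboolP; exists 'X; rewrite map_polyX hornerX. Qed.

Definition phiZ : Zphi := MkZphi phi_Zphi.

Lemma phiZ_sqr : phiZ * phiZ = phiZ + 1.
Proof. by apply: val_inj; rewrite /= -expr2 phi_sqr. Qed.

Lemma ZphiP (x : Zphi) : exists a b : int, x = a%:~R + b%:~R * phiZ.
Proof.
case: x => x Px; have /asboolP[P xE] := Px.
suff [a [b ab]] : exists a b : int, x = a%:~R + b%:~R * phi.
  by exists a, b; apply: val_inj; rewrite rmorphD rmorphM !rmorph_int.
rewrite {}xE {x Px}; elim/poly_ind: P => [|P c [a [b IH]]].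
  by exists 0, 0; rewrite rmorph0 horner0 mul0r addr0.
exists (b + c), (a + b).
rewrite rmorphD rmorphM /= map_polyX map_polyC /= hornerD hornerMX hornerC IH.
rewrite mulrDl -mulrA -expr2 phi_sqr mulrDr mulr1 !rmorphD /= mulrDl.
by ring.
Qed.

(* The modulus is q.-1.+1, i.e. q for every q >= 1; the junk value q = 0 is
   sent to modulus 1 so that Zphi_mod q is a finite ring for all q. *)
Section ZphiMod.
Variable q : nat.

Definition qZphi : {pred Zphi} :=
  fun x => `[< exists y : Zphi, x = q.-1.+1%:R * y >].

Fact qZphi_zmod : zmod_closed qZphi.
Proof.
split=> [|x y /asboolP[u ->] /asboolP[v ->]]; apply/asboolP.
  by exists 0; rewrite mulr0.
by exists (u - v); rewrite mulrBr.
Qed.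

Fact qZphiM a : {in qZphi, forall x, a * x \in qZphi}.
Proof. by move=> x /asboolP[u ->]; apply/asboolP; exists (a * u); rewrite mulrCA. Qed.

HB.instance Definition _ := GRing.isZmodClosed.Build Zphi qZphi qZphi_zmod.

Definition Zphi_mod := Quotient.quot qZphi.

HB.instance Definition _ := GRing.Zmodule.on Zphi_mod.
HB.instance Definition _ : EqQuotient Zphi (Quotient.equiv qZphi) Zphi_mod :=
  EqQuotient.on Zphi_mod.
HB.instance Definition _ := ZmodQuotient.on Zphi_mod.

Definition Zphi_proj : Zphi -> Zphi_mod := \pi_Zphi_mod%qT.

(* ring_quotient.v only covers proper ideals, hence not q = 1 *)
Definition Zphi_mod_one : Zphi_mod := Zphi_proj 1.
Definition Zphi_mod_mul (x y : Zphi_mod) : Zphi_mod :=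
  Zphi_proj (repr x * repr y).

Lemma Zphi_projP (x y : Zphi) :
  reflect (exists z, x - y = q.-1.+1%:R * z) (Zphi_proj x == Zphi_proj y).
Proof.
rewrite /Zphi_proj -Quotient.idealrBE.
exact: asboolP.
Qed.

Fact Zphi_proj_repr : cancel repr Zphi_proj. Proof. exact: reprK. Qed.

Fact Zphi_projD : {morph Zphi_proj : x y / x + y}.
Proof. by move=> x y; rewrite /Zphi_proj Quotient.pi_add. Qed.

Fact Zphi_projM x y : Zphi_proj (x * y) = Zphi_mod_mul (Zphi_proj x) (Zphi_proj y).
Proof.
have [u xE] := Zphi_projP _ _ (introT eqP (Zphi_proj_repr (Zphi_proj x))).
have [v yE] := Zphi_projP _ _ (introT eqP (Zphi_proj_repr (Zphi_proj y))).
apply/esym/eqP/Zphi_projP; rewrite -(subrK x (repr _)) xE.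
rewrite -(subrK y (repr (Zphi_proj y))) yE.
set n := _%:R; exists (u * (n * v + y) + x * v).
by ring.
Qed.

Fact Zphi_mod_mulA : associative Zphi_mod_mul.
Proof.
move=> x y z; rewrite -(Zphi_proj_repr x) -(Zphi_proj_repr y).
by rewrite -(Zphi_proj_repr z) -!Zphi_projM mulrA.
Qed.

Fact Zphi_mod_mulC : commutative Zphi_mod_mul.
Proof. by move=> x y; rewrite /Zphi_mod_mul mulrC. Qed.

Fact Zphi_mod_mul1 : left_id Zphi_mod_one Zphi_mod_mul.
Proof. by move=> x; rewrite -(Zphi_proj_repr x) -Zphi_projM mul1r. Qed.

Fact Zphi_mod_mulDl : left_distributive Zphi_mod_mul +%R.
Proof.
move=> x y z; rewrite -(Zphi_proj_repr x) -(Zphi_proj_repr y).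
by rewrite -(Zphi_proj_repr z) -Zphi_projD -!Zphi_projM -Zphi_projD mulrDl.
Qed.

HB.instance Definition _ := GRing.Zmodule_isComPzRing.Build Zphi_mod
  Zphi_mod_mulA Zphi_mod_mulC Zphi_mod_mul1 Zphi_mod_mulDl.

Fact Zphi_proj_is_zmod_morphism : zmod_morphism Zphi_proj.
Proof. by move=> x y; rewrite /Zphi_proj raddfB. Qed.

Fact Zphi_proj_is_monoid_morphism : monoid_morphism Zphi_proj.
Proof. by split=> // x y; rewrite Zphi_projM. Qed.

HB.instance Definition _ := GRing.isZmodMorphism.Build Zphi Zphi_mod Zphi_proj
  Zphi_proj_is_zmod_morphism.
HB.instance Definition _ := GRing.isMonoidMorphism.Build Zphi Zphi_mod Zphi_proj
  Zphi_proj_is_monoid_morphism.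

Let enum_fun (ab : 'I_q.-1.+1 * 'I_q.-1.+1) : Zphi_mod :=
  Zphi_proj ((ab.1 : nat)%:R + (ab.2 : nat)%:R * phiZ).

Fact Zphi_mod_enumP : Finite.axiom (undup (codom enum_fun)).
Proof.
apply: Finite.uniq_enumP; first exact: undup_uniq.
move=> x; rewrite mem_undup; apply/codomP.
have [a [b xE]] := ZphiP (repr x).
pose n : int := q.-1.+1%:Z.
have red (c : int) : exists (i : 'I_q.-1.+1) (d : int), c = i%:Z + n * d.
  have c0 : 0 <= (c %% n)%Z by exact: modz_ge0.
  have cn : (`|(c %% n)%Z| < q.-1.+1)%N.
    by rewrite -ltz_nat gez0_abs // ltz_pmod.
  exists (Ordinal cn), (c %/ n)%Z => /=.
  by rewrite gez0_abs // addrC mulrC -divz_eq.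
have [i [u aE]] := red a; have [j [v bE]] := red b.
exists (i, j); rewrite /enum_fun /= -(Zphi_proj_repr x) xE.
apply/eqP/Zphi_projP; exists (u%:~R + v%:~R * phiZ).
rewrite aE bE !rmorphD !rmorphM /= mulrDl opprD addrACA.
by rewrite -!pmulrn [_ + _ - i%:R]addrC addKr [_ * phiZ + _ - _]addrC addKr mulrDr mulrA.
Qed.

Let Zphi_mod_pick (x : Zphi_mod) : nat := index x (undup (codom enum_fun)).
Let Zphi_mod_unpick (k : nat) : option Zphi_mod :=
  onth (undup (codom enum_fun)) k.
Fact Zphi_mod_pickK : pcancel Zphi_mod_pick Zphi_mod_unpick.
Proof.
move=> x; have xin : x \in undup (codom enum_fun).
  by rewrite -has_pred1 has_count Zphi_mod_enumP.
rewrite /Zphi_mod_unpick; apply/eqP; rewrite onthE (nth_map x) ?index_mem //.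
by rewrite nth_index.
Qed.

HB.instance Definition _ :=
  Choice_isCountable.Build Zphi_mod Zphi_mod_pickK.
HB.instance Definition _ := isFinite.Build Zphi_mod Zphi_mod_enumP.

End ZphiMod.

Fact detA : 1 * 1 - phiZ * 0 = 1.
Proof. by ring. Qed.
Fact detB : 1 * 1 - 0 * phiZ = 1.
Proof. by ring. Qed.
Fact detC : phiZ * phiZ - phiZ * 1 = 1.
Proof. by ring: phiZ_sqr. Qed.
Fact detD : phiZ * phiZ - 1 * phiZ = 1.
Proof. by ring: phiZ_sqr. Qed.

Definition matA : SL2 Zphi := @SL2_of Zphi 1 phiZ 0 1 detA.
Definition matB : SL2 Zphi := @SL2_of Zphi 1 0 phiZ 1 detB.
Definition matC : SL2 Zphi := @SL2_of Zphi phiZ phiZ 1 phiZ detC.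
Definition matD : SL2 Zphi := @SL2_of Zphi phiZ 1 phiZ phiZ detD.

(* the intersection of all subgroups of SL2 Zphi containing A, B, C and D *)
Definition Gamma : {pred SL2 Zphi} := fun g =>
  `[< forall H : {pred SL2 Zphi}, group_closed H ->
        {subset [:: matA; matB; matC; matD] <= H} -> g \in H >].

Definition fullG : {pred SL2 Zphi} := predT.

Fact Gamma_group_closed : group_closed Gamma.
Proof.
split=> [|x y /asboolP Hx /asboolP Hy]; apply/asboolP => H gH sH.
  exact: gH.1.
by apply: gH.2; [apply: Hx | apply: Hy].
Qed.

Fact fullG_group_closed : group_closed fullG. Proof. by []. Qed.

Definition SL2mod (q : nat) : finGroupType := SL2 (Zphi_mod q).

Section Reduction.
Variable q : nat.

Definition reduce : SL2 Zphi -> SL2mod q := SL2_map (@Zphi_proj q).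

Lemma reduce1 : reduce 1%g = 1%g. Proof. exact: gmulf1. Qed.
Lemma reduceM : {morph reduce : x y / (x * y)%g}. Proof. exact: gmulfM. Qed.

(* the image of H under reduction modulo q, e.g. Gamma(q')/Gamma(q) for
   H = Gamma(q') *)
Definition image_mod (H : {pred SL2 Zphi}) : {set SL2mod q} :=
  [set x | `[< exists2 g, g \in H & reduce g = x >]].

Fact image_mod_group_set (H : {pred SL2 Zphi}) :
  group_closed H -> group_set (image_mod H).
Proof.
move=> gH; apply/group_setP; split=> [|x y].
  by rewrite inE; apply/asboolP; exists 1%g; rewrite ?reduce1 ?gH.1.
rewrite !inE => /asboolP[g gin <-] /asboolP[h hin <-]; apply/asboolP.
by exists (g * h)%g; [apply: group_closedM | rewrite reduceM].
Qed.

Definition Gamma_mod : {group SL2mod q} :=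
  Group (image_mod_group_set Gamma_group_closed).
Definition G_mod : {group SL2mod q} :=
  Group (image_mod_group_set fullG_group_closed).

Definition G_ker : {pred SL2 Zphi} := [pred g | reduce g == 1%g].
Definition Gamma_ker : {pred SL2 Zphi} := [predI Gamma & G_ker].
End Reduction.

(* the prime power p ^ e_p exactly dividing q, for p a prime divisor of q *)
Definition ppart (q : nat) (p : seq_sub (primes q)) : nat :=
  (ssval p ^ logn (ssval p) q)%N.

Definition SL2prod (q : nat) : finGroupType :=
  {dffun forall p : seq_sub (primes q), SL2mod (ppart p)}.

Definition Gamma_prod (q : nat) : {group SL2prod q} :=
  setXn_group (fun p : seq_sub (primes q) => Gamma_mod (ppart p)).

(* Main.v *)
Require Import Defs.
From mathcomp Require Import all_boot all_order all_algebra all_fingroup all_field.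
From mathcomp Require Import generic_quotient boolp ring zify.

(* Write u(x) and v(x) for the upper and lower unipotent matrices. Gamma is
   already generated by A = u(phi) and B = v(phi). By the Chinese remainder
   theorem a suitable power of A is A mod p^e and trivial modulo the other prime
   powers dividing q, and likewise for B; this gives (i) and reduces (ii) to
   prime powers. Modulo p^e the exponents of A and B may be taken p-adic, and two
   words in such powers, with exponents having denominators 2 and 3 respectively,
   are upper triangular. Conjugating u(phi) by them yields u(12) for p odd and
   u(8) for p = 2, then u(4) by a finite computation mod 8. Hence the image of
   Gamma contains all u(d x), v(d x) with d = 1, 3, 4 according to p >= 5, p = 3,
   p = 2, and these together with u(phi) generate the kernel of reduction mod d.
   For (iii) the index is 6 mod 3 and 12 mod 4, by enumerating cosets. *)

Set Implicit Arguments.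
Unset Strict Implicit.
Unset Printing Implicit Defensive.

Import Order.TTheory GRing.Theory Num.Theory.

Local Open Scope ring_scope.

(** * Unipotent matrices *)

Section Unipotent.
Variable R : comPzRingType.
Implicit Types (a b c d x y : R) (g h : SL2 R).

Lemma mx2_eta (M : 'M[R]_2) : M = mx2 (M 0 0) (M 0 1) (M 1 0) (M 1 1).
Proof.
apply/matrixP=> i j; rewrite mxE.
by case: i j => [[|[|[]]] //= ?] [[|[|[]]] //= ?]; congr (M _ _); apply: val_inj.
Qed.

Lemma mulmx2 a b c d a' b' c' d' :
  mx2 a b c d *m mx2 a' b' c' d' =
  mx2 (a * a' + b * c') (a * b' + b * d') (c * a' + d * c') (c * b' + d * d').
Proof.
apply/matrixP=> i j; rewrite !mxE !big_ord_recl big_ord0 addr0 !mxE /=.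
by case: ifP; case: ifP.
Qed.

Lemma mx2_1 : 1%:M = mx2 1 0 0 1 :> 'M[R]_2.
Proof. by rewrite [LHS]mx2_eta !mxE. Qed.

Lemma mx2_inj a b c d a' b' c' d' : mx2 a b c d = mx2 a' b' c' d' ->
  [/\ a = a', b = b', c = c' & d = d'].
Proof.
move=> /matrixP E; split; [have := E 0 0 | have := E 0 1 |
  have := E 1 0 | have := E 1 1]; by rewrite !mxE.
Qed.

Fact upper_subproof x : 1 * 1 - x * 0 = 1 :> R. Proof. by ring. Qed.
Fact lower_subproof x : 1 * 1 - 0 * x = 1 :> R. Proof. by ring. Qed.
Fact weyl_subproof : 0 * 0 - (-1) * 1 = 1 :> R. Proof. by ring. Qed.

Definition upper x : SL2 R := SL2_of (upper_subproof x).
Definition lower x : SL2 R := SL2_of (lower_subproof x).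
Definition weyl : SL2 R := SL2_of weyl_subproof.

Lemma upperD x y : upper (x + y) = (upper x * upper y)%g.
Proof. by apply: val_inj; rewrite /= mulmx2; congr mx2; ring. Qed.

Lemma upper0 : upper 0 = 1%g.
Proof. by apply: val_inj; rewrite /= mx2_1. Qed.

Lemma upperMn x n : upper (x *+ n) = (upper x ^+ n)%g.
Proof.
by elim: n => [|n IH]; [rewrite upper0 | rewrite mulrS upperD IH expgS].
Qed.

Lemma lowerD x y : lower (x + y) = (lower x * lower y)%g.
Proof. by apply: val_inj; rewrite /= mulmx2; congr mx2; ring. Qed.

Lemma lower0 : lower 0 = 1%g.
Proof. by apply: val_inj; rewrite /= mx2_1. Qed.

Lemma lowerMn x n : lower (x *+ n) = (lower x ^+ n)%g.
Proof.
by elim: n => [|n IH]; [rewrite lower0 | rewrite mulrS lowerD IH expgS].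
Qed.

Lemma upperN x : upper (- x) = (upper x)^-1%g.
Proof.
apply: (mulgI (upper x)); rewrite mulgV -upperD subrr; exact: upper0.
Qed.

Lemma lowerN x : lower (- x) = (lower x)^-1%g.
Proof.
apply: (mulgI (lower x)); rewrite mulgV -lowerD subrr; exact: lower0.
Qed.

Lemma upperJ x : (weyl * upper x)%g = (lower (- x) * weyl)%g.
Proof. by apply: val_inj; rewrite /= !mulmx2; congr mx2; ring. Qed.

Lemma SL2_det g : g 0 0 * g 1 1 - g 0 1 * g 1 0 = 1.
Proof. by rewrite -det_mx2 -mx2_eta SL2det. Qed.

(** With a unit in the corner, the determinant relation can be solved for the fourth entry, so three
    entries determine the matrix. *)
Lemma SL2_eq_unit g h w : w * g 0 0 = 1 ->
  g 0 0 = h 0 0 -> g 0 1 = h 0 1 -> g 1 0 = h 1 0 -> g = h.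
Proof.
move=> wg E1 E2 E3; apply: val_inj => /=.
rewrite (mx2_eta g) (mx2_eta h) E1 E2 E3; congr mx2.
move: (SL2_det g) (SL2_det h); rewrite -E1 -E2 -E3 => dg dh.
have E : g 0 0 * g 1 1 = g 0 0 * h 1 1.
  by rewrite -[LHS](subrK (g 0 1 * g 1 0)) dg -dh subrK.
by rewrite -[LHS]mul1r -[RHS]mul1r -wg -!mulrA E.
Qed.

(* Gauss decomposition, with [diag(w, 1/w)] expanded through
   [u(s) v(t) = v(t/w) diag(w, 1/w) u(s/w)] where [w = 1 + s t]. *)
Lemma SL2_factor g w s t : w * g 0 0 = 1 -> g 0 0 = 1 + s * t ->
  g = (lower (w * (g 1 0 - t))%R * upper s * lower t *
       upper (w * (g 0 1 - s))%R)%g.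
Proof.
move=> wg st; have wst : w * s * t = 1 - w by rewrite -[in RHS]wg st; ring.
apply: (SL2_eq_unit wg); rewrite /= !mulmx2 !mxE /= ?st; first by ring.
- by ring: wst.
- by ring: wst.
Qed.

(** The other diagonal entry is inverse to [g 0 0], so conjugation scales by a square; this is the
    source of new unipotents. *)
Lemma upper_conj g x : g 1 0 = 0 ->
  (g * upper x)%g = (upper (g 0 0 * g 0 0 * x)%R * g)%g.
Proof.
move=> g10; have := SL2_det g; rewrite g10 mulr0 subr0 => dg.
apply: val_inj => /=; move: (mx2_eta g) dg; rewrite g10.
move: (g 0 0) (g 0 1) (g 1 1) => a b d -> dg; rewrite !mulmx2.
by congr mx2; ring: dg.
Qed.

End Unipotent.

(** * Reduction, and generation of Gamma by A and B *)

Section ReductionTheory.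
Implicit Types (g h : SL2 Zphi) (m n p q : nat).

Lemma intr_Zphi_inj : injective (intr : int -> Zphi).
Proof.
move=> a b /(congr1 (val : Zphi -> algC)); rewrite !rmorph_int.
exact: intr_inj.
Qed.

(** The 5-adic valuation is even on the left and odd on the right, unless both sides vanish. *)
Lemma sqr_eq5sqr (m n : nat) : (m ^ 2 = 5 * n ^ 2)%N -> n = 0%N.
Proof.
move=> E; case: (posnP n) => // n0; have m0 : (0 < m)%N.
  rewrite lt0n; apply/eqP => m0; have /esym/eqP := E.
  by rewrite m0 muln_eq0 expn_eq0 /= andbT => /eqP n00; rewrite n00 in n0.
have := congr1 (logn 5) E; rewrite lognM ?expn_gt0 ?n0 // !lognX.
have -> : logn 5 5 = 1%N by [].
by move: (logn 5 m) (logn 5 n) => i j; clear; lia.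
Qed.

(** A zero has norm [a * a + a * b - b * b] equal to 0, and four times this norm is
    [(2 * a + b) ^ 2 - 5 * b ^ 2]. *)
Lemma zint_eq0 (a b : int) : a%:~R + b%:~R * phiZ = 0 -> a = 0 /\ b = 0.
Proof.
move=> E; have N0 : a * a + a * b - b * b = 0.
  apply: intr_Zphi_inj; rewrite rmorph0 !(rmorphD, rmorphN, rmorphM) /=.
  have -> : a%:~R * a%:~R + a%:~R * b%:~R - b%:~R * b%:~R =
     (a%:~R + b%:~R * phiZ) * (a%:~R + b%:~R - b%:~R * phiZ) :> Zphi.
    by ring: phiZ_sqr.
  by rewrite E mul0r.
have b0 : b = 0.
  have E2 : (absz (2 * a + b)%R ^ 2 = 5 * absz b ^ 2)%N by nia.
  by have := sqr_eq5sqr E2; lia.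
by split=> //; move: N0; rewrite b0; lia.
Qed.

(** As 1 and [phiZ] are independent over the integers, divisibility in Z[phi] is tested on
    coordinates; the Chinese remainder arguments rest on this. *)
Lemma Zphi_proj_eq0 (q : nat) (a b : int) : (0 < q)%N ->
  (Zphi_proj q (a%:~R + b%:~R * phiZ) == 0) = (q %| a)%Z && (q %| b)%Z.
Proof.
move=> q0; rewrite -(rmorph0 (Zphi_proj q)); apply/Zphi_projP/andP.
  rewrite prednK // subr0 => -[z]; have [c [d ->]] := ZphiP z => E.
  have [] := @zint_eq0 (a - q%:Z * c) (b - q%:Z * d).
    rewrite !(rmorphD, rmorphN, rmorphM) /= mulrBl addrACA E -opprD -mulrA -mulrDr.
    exact: subrr.
  by move=> /subr0_eq -> /subr0_eq ->; rewrite !dvdz_mulr.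
move=> [/dvdzP[c ->] /dvdzP[d ->]]; exists (c%:~R + d%:~R * phiZ).
by rewrite prednK // subr0 !rmorphM /=; ring.
Qed.

Lemma Zphi_proj_nat0 q : (0 < q)%N -> q%:R = 0 :> Zphi_mod q.
Proof.
move=> q0; apply/eqP; have := Zphi_proj_eq0 q%:Z 0 q0.
by rewrite rmorph0 mul0r addr0 rmorph_nat dvdzz dvdz0 => ->.
Qed.

Lemma Zphi_proj_dvd m q x : (m %| q)%N -> (0 < q)%N ->
  Zphi_proj q x = 0 -> Zphi_proj m x = 0.
Proof.
move=> mq q0; have m0 := dvdn_gt0 q0 mq; have [a [b ->]] := ZphiP x.
move=> /eqP; rewrite Zphi_proj_eq0 // => /andP[qa qb]; apply/eqP.
by rewrite Zphi_proj_eq0 // (dvdz_trans _ qa) // (dvdz_trans _ qb).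
Qed.

Lemma Zphi_proj_parts q x : (0 < q)%N ->
  (forall p, p \in primes q -> Zphi_proj (p ^ logn p q)%N x = 0) ->
  Zphi_proj q x = 0.
Proof.
move=> q0; have [a [b ->]] := ZphiP x => H; apply/eqP.
rewrite Zphi_proj_eq0 // !dvdzE /=.
have D p : p \in \pi(q) -> (q`_p %| `|a|)%N && (q`_p %| `|b|)%N.
  move=> pq; rewrite p_part; have /eqP := H p pq.
  by rewrite Zphi_proj_eq0 ?pfactor_gt0.
by apply/andP; split; apply/dvdn_partP => // p /D /andP[].
Qed.

Lemma reduceP q g h :
  (forall i j, Zphi_proj q (g i j - h i j) = 0) <-> reduce q g = reduce q h.
Proof.
split=> [E|E i j].
  apply: val_inj; apply/matrixP=> i j; rewrite !mxE.
  by have := E i j; rewrite rmorphB => /subr0_eq.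
have := congr1 (fun x : SL2mod q => SL2val x i j) E; rewrite !mxE.
by rewrite rmorphB => ->; rewrite subrr.
Qed.

Lemma reduce_dvd m q g h : (m %| q)%N -> (0 < q)%N ->
  reduce q g = reduce q h -> reduce m g = reduce m h.
Proof.
by move=> mq q0 /reduceP E; apply/reduceP => i j; apply: (Zphi_proj_dvd mq).
Qed.

Lemma reduce_parts q g h : (0 < q)%N ->
  (forall p, p \in primes q -> reduce (p ^ logn p q) g = reduce (p ^ logn p q) h) ->
  reduce q g = reduce q h.
Proof.
move=> q0 E; apply/reduceP => i j; apply: Zphi_proj_parts => // p pq.
by have /reduceP := E p pq.
Qed.

Lemma reduce_coprime m n g h : (0 < m)%N -> (0 < n)%N -> coprime m n ->
  reduce m g = reduce m h -> reduce n g = reduce n h ->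
  reduce (m * n) g = reduce (m * n) h.
Proof.
move=> m0 n0 mn /reduceP E /reduceP F; apply/reduceP => i j.
move: {E F}(E i j) (F i j); have [a [b ->]] := ZphiP (g i j - h i j).
move=> /eqP; rewrite Zphi_proj_eq0 // => /andP[ma mb] /eqP.
rewrite Zphi_proj_eq0 // => /andP[na nb]; apply/eqP.
by rewrite Zphi_proj_eq0 ?muln_gt0 ?m0 // PoszM !Gauss_dvdz ?ma ?mb ?na ?nb.
Qed.

Lemma reduce_upper q x : reduce q (upper x) = upper (Zphi_proj q x).
Proof.
apply: val_inj => /=; rewrite [LHS]mx2_eta !mxE /=.
by rewrite rmorph0 rmorph1.
Qed.

Lemma reduce_lower q x : reduce q (lower x) = lower (Zphi_proj q x).
Proof.
apply: val_inj => /=; rewrite [LHS]mx2_eta !mxE /=.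
by rewrite rmorph0 rmorph1.
Qed.

Lemma reduceV q : {morph reduce q : x / x^-1%g}. Proof. exact: gmulfV. Qed.

Lemma matA_upper : matA = upper phiZ. Proof. exact: val_inj. Qed.
Lemma matB_lower : matB = lower phiZ. Proof. exact: val_inj. Qed.

(* From [S^2 = (ST)^5 = -1], with [S = weyl], [T = A] and [S T S^-1 = B^-1],
   one gets [A^-1 B A^-1 B A^-1 = -S = S^3]. *)
Lemma weyl_word :
  weyl Zphi = ((matA^-1 * matB * matA^-1 * matB * matA^-1) ^+ 3)%g.
Proof.
have d : 0 * 0 - 1 * (-1) = 1 :> Zphi by ring.
have -> : (matA^-1 * matB * matA^-1 * matB * matA^-1)%g = SL2_of d.
  rewrite matA_upper matB_lower -upperN; apply: val_inj; rewrite /= !mulmx2.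
  by congr mx2; ring: phiZ_sqr.
by apply: val_inj; rewrite /= !mulmx2; congr mx2; ring.
Qed.

Lemma matC_word : matC = (matA * weyl Zphi * matA)%g.
Proof. by apply: val_inj; rewrite /= !mulmx2; congr mx2; ring: phiZ_sqr. Qed.

Lemma matD_word : (matC * weyl Zphi * matD)%g = weyl Zphi.
Proof. by apply: val_inj; rewrite /= !mulmx2; congr mx2; ring: phiZ_sqr. Qed.

Lemma group_closedX (H : {pred SL2 Zphi}) g k :
  group_closed H -> g \in H -> (g ^+ k)%g \in H.
Proof.
move=> gH Hg; elim: k => [|k IH]; first by rewrite gH.1.
by rewrite expgS group_closedM.
Qed.

(** Induction principle with two generators: [weyl] is a word in A and B, C is a word in A and
    [weyl], and D is solved from [matD_word]. *)
Lemma Gamma_min (H : {pred SL2 Zphi}) : group_closed H ->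
  matA \in H -> matB \in H -> {subset Gamma <= H}.
Proof.
move=> gH HA HB g /asboolP; apply=> //.
have HM := group_closedM gH; have HV := group_closedV gH.
have HW : weyl Zphi \in H.
  by rewrite weyl_word group_closedX // !(HM, HV).
have HC : matC \in H by rewrite matC_word !HM.
have -> : matD = ((matC * weyl Zphi)^-1 * weyl Zphi)%g.
  by rewrite -[in X in (_ * X)%g]matD_word mulKg.
move=> x; rewrite !inE => /or4P[] /eqP-> //.
by apply: (HM) => //; apply: HV; apply: HM.
Qed.

Lemma Gamma_A : matA \in Gamma.
Proof. by apply/asboolP => H _; apply; rewrite inE eqxx. Qed.

Lemma Gamma_B : matB \in Gamma.
Proof. by apply/asboolP => H _; apply; rewrite !inE eqxx orbT. Qed.

Lemma Gamma_weyl : weyl Zphi \in Gamma.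
Proof.
have HM := group_closedM Gamma_group_closed.
have HV := group_closedV Gamma_group_closed.
have [HA HB] := (Gamma_A, Gamma_B).
by rewrite weyl_word group_closedX // ?(HM, HV) //; exact: Gamma_group_closed.
Qed.

(** * Independence of reductions modulo coprime integers *)

Definition isolates (m n : nat) (H : {pred SL2 Zphi}) : Prop :=
  forall g, g \in H ->
  exists2 h, h \in H & reduce m h = reduce m g /\ reduce n h = 1%g.

(** The elements that can be isolated form a group, so isolation need only be checked on
    generators. *)
Lemma isolated_group_closed m n (H : {pred SL2 Zphi}) : group_closed H ->
  group_closed [pred g | `[< exists2 h, h \in H &
                     reduce m h = reduce m g /\ reduce n h = 1%g >]].
Proof.
move=> gH; split=> [|x y /asboolP[h Hh [h1 h2]] /asboolP[k Hk [k1 k2]]].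
  by apply/asboolP; exists 1%g; [exact: gH.1 | rewrite !reduce1].
apply/asboolP; exists (h * k^-1)%g; first exact: gH.2.
by rewrite !reduceM !reduceV h1 k1 h2 k2 mulgV.
Qed.

Lemma coprime_nat_lift m n : (0 < m)%N -> (0 < n)%N -> coprime m n ->
  exists k : nat, k%:R = 1 :> Zphi_mod m /\ k%:R = 0 :> Zphi_mod n.
Proof.
move=> m0 n0 mn; exists (chinese m n 1 0); split.
  rewrite [X in X%:R](divn_eq _ m) natrD natrM Zphi_proj_nat0 // mulr0 add0r.
  rewrite chinese_modl // -[RHS]/(1%:R).
  rewrite [X in _ = X%:R](divn_eq _ m) natrD natrM Zphi_proj_nat0 //.
  by rewrite mulr0 add0r.
rewrite [X in X%:R](divn_eq _ n) natrD natrM Zphi_proj_nat0 // mulr0 add0r.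
by rewrite chinese_modr // mod0n.
Qed.

(** The k-th power of [upper x] is [upper (x *+ k)]; take k to be 1 modulo [m] and 0 modulo [n]. *)
Lemma upper_isolated m n (x : Zphi) (H : {pred SL2 Zphi}) : group_closed H ->
  (0 < m)%N -> (0 < n)%N -> coprime m n -> upper x \in H ->
  exists2 h, h \in H & reduce m h = reduce m (upper x) /\ reduce n h = 1%g.
Proof.
move=> gH m0 n0 mn Hx; have [k [k1 k0]] := coprime_nat_lift m0 n0 mn.
exists (upper x ^+ k)%g; first exact: group_closedX.
rewrite -upperMn !reduce_upper -mulr_natr !rmorphM !rmorph_nat.
by rewrite k1 k0 mulr1 mulr0 upper0.
Qed.

Lemma lower_isolated m n (x : Zphi) (H : {pred SL2 Zphi}) : group_closed H ->
  (0 < m)%N -> (0 < n)%N -> coprime m n -> lower x \in H ->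
  exists2 h, h \in H & reduce m h = reduce m (lower x) /\ reduce n h = 1%g.
Proof.
move=> gH m0 n0 mn Hx; have [k [k1 k0]] := coprime_nat_lift m0 n0 mn.
exists (lower x ^+ k)%g; first exact: group_closedX.
rewrite -lowerMn !reduce_lower -mulr_natr !rmorphM !rmorph_nat.
by rewrite k1 k0 mulr1 mulr0 lower0.
Qed.

Lemma Gamma_isolates m n : (0 < m)%N -> (0 < n)%N -> coprime m n ->
  isolates m n Gamma.
Proof.
move=> m0 n0 mn g gG; apply/asboolP; move: g gG; apply: Gamma_min.
- exact: isolated_group_closed Gamma_group_closed.
- apply/asboolP; rewrite matA_upper; apply: upper_isolated => //.
    exact: Gamma_group_closed.
  by rewrite -matA_upper Gamma_A.
- apply/asboolP; rewrite matB_lower; apply: lower_isolated => //.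
    exact: Gamma_group_closed.
  by rewrite -matB_lower Gamma_B.
Qed.

(** Surjectivity in the Chinese remainder theorem: primes are treated one at a time, each new factor
    altering a single local component. *)
Lemma Gamma_glue q (y : nat -> SL2 Zphi) : (0 < q)%N ->
  (forall p, p \in primes q -> y p \in Gamma) ->
  exists2 g, g \in Gamma & forall p, p \in primes q ->
    reduce (p ^ logn p q) g = reduce (p ^ logn p q) (y p).
Proof.
move=> q0 Gy.
suff: forall s, uniq s -> {subset s <= primes q} ->
  exists2 g, g \in Gamma & forall p, p \in primes q ->
    reduce (p ^ logn p q) g = if p \in s then reduce (p ^ logn p q) (y p) else 1%g.
  move=> /(_ _ (primes_uniq q) (fun _ => id))[g gG E]; exists g => // p pq.
  by rewrite E // pq.
elim=> [_ _|p s IH /= /andP[ps us] sq].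
  by exists 1%g; rewrite ?Gamma_group_closed.1 // => p _; rewrite reduce1.
have pq : p \in primes q by rewrite sq // mem_head.
have [g gG gE] := IH us (fun r rs => sq r (mem_behead (s := p :: s) rs)).
have m0 r : r \in primes q -> (0 < r ^ logn r q)%N.
  by rewrite mem_primes expn_gt0 => /andP[/prime_gt0->].
(* The other prime powers all divide the prime-to-p part of [q], so one coprime modulus isolates [p]
   from all of them. *)
have c : coprime (p ^ logn p q) q`_(p^').
  by rewrite -p_part coprime_partC.
have [h hG [h1 h2]] := Gamma_isolates (m0 p pq) (part_gt0 _ _) c (Gy p pq).
exists (h * g)%g; first exact: group_closedM Gamma_group_closed _ _ hG gG.
move=> r rq; rewrite reduceM gE // inE; case: eqVneq => [->|rp] /=.
  by rewrite (negPf ps) mulg1 h1.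
suff -> : reduce (r ^ logn r q) h = 1%g by rewrite mul1g.
rewrite -(reduce1 (r ^ logn r q)).
apply: (@reduce_dvd _ q`_(p^')); rewrite ?reduce1 ?h2 //.
rewrite -p_part; apply: sub_in_partn => t _ /eqP ->; rewrite inE /= inE /=.
by rewrite rp.
Qed.
End ReductionTheory.

(** * Unipotents in Gamma modulo q *)

Lemma image_modP q (H : {pred SL2 Zphi}) (x : SL2mod q) :
  (exists2 g, g \in H & reduce q g = x) <-> x \in image_mod q H.
Proof. by rewrite inE; split=> [?|/asboolP//]; apply/asboolP. Qed.

Lemma mem_image_mod q (H : {pred SL2 Zphi}) g :
  g \in H -> reduce q g \in image_mod q H.
Proof. by move=> Hg; apply/image_modP; exists g. Qed.

Lemma coprime_unit q a : (0 < q)%N -> coprime a q ->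
  exists k : nat, k%:R * a%:R = 1 :> Zphi_mod q.
Proof.
move=> q0 aq; case: (posnP a) => [a0|a0].
  (* Coprimality of 0 to [q] forces [q = 1], and in the zero ring the inverse 0 works. *)
  move: aq; rewrite a0 /coprime gcd0n => /eqP q1; exists 0%N; rewrite mul0r.
  by subst q; exact/esym/(Zphi_proj_nat0 q0).
case: (@egcdnP a q a0) => u v E _; exists u.
rewrite -natrM E (eqP aq) natrD natrM Zphi_proj_nat0 //.
by rewrite mulr0 add0r.
Qed.

Lemma group_upperMz q (K : {group SL2mod q}) (x : Zphi_mod q) (c : int) :
  upper x \in K -> upper (x * c%:~R) \in K.
Proof.
move=> Kx; case: (intP c) => [|n|n].
- by rewrite mulr0 upper0 group1.
- by rewrite -pmulrn mulr_natr upperMn groupX.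
- by rewrite mulrNz -pmulrn mulrN upperN groupV mulr_natr upperMn groupX.
Qed.

Lemma group_lowerMz q (K : {group SL2mod q}) (x : Zphi_mod q) (c : int) :
  lower x \in K -> lower (x * c%:~R) \in K.
Proof.
move=> Kx; case: (intP c) => [|n|n].
- by rewrite mulr0 lower0 group1.
- by rewrite -pmulrn mulr_natr lowerMn groupX.
- by rewrite mulrNz -pmulrn mulrN lowerN groupV mulr_natr lowerMn groupX.
Qed.

Section Local.
Variable q : nat.
Hypothesis q0 : (0 < q)%N.

Local Notation Rq := (Zphi_mod q).
Local Notation K := (Gamma_mod q).
Local Notation f := (Zphi_proj q phiZ : Rq).

Lemma proj_phi_sqr : f * f = f + 1.
Proof. by rewrite -rmorphM phiZ_sqr rmorphD rmorph1. Qed.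

Lemma Gamma_mod_upper k : upper (f * k%:R) \in K.
Proof.
rewrite mulr_natr upperMn groupX // -reduce_upper -matA_upper.
exact: mem_image_mod Gamma_A.
Qed.

Lemma Gamma_mod_lower k : lower (f * k%:R) \in K.
Proof.
rewrite mulr_natr lowerMn groupX // -reduce_lower -matB_lower.
exact: mem_image_mod Gamma_B.
Qed.

Lemma reduce_weyl : reduce q (weyl Zphi) = weyl Rq.
Proof.
apply: val_inj => /=; rewrite [LHS]mx2_eta !mxE /=.
by rewrite rmorphN rmorph0 rmorph1.
Qed.

Lemma Gamma_mod_weyl : weyl Rq \in K.
Proof. rewrite -reduce_weyl; exact: mem_image_mod Gamma_weyl. Qed.

(** Conjugation by [weyl] swaps the two kinds of unipotents, so only upper ones need to be
    constructed. *)
Lemma Gamma_mod_lower_upper x : upper x \in K -> lower x \in K.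
Proof.
move=> Kx; have -> : lower x = (weyl Rq * (upper x)^-1 * (weyl Rq)^-1)%g.
  by rewrite -upperN upperJ opprK mulgK.
by rewrite !groupM ?groupV // Gamma_mod_weyl.
Qed.

Lemma Gamma_mod_upper_conj g x : g \in K -> SL2val g 1 0 = 0 ->
  upper x \in K -> upper (g 0 0 * g 0 0 * x) \in K.
Proof.
move=> Kg g10 Kx; have -> : upper (g 0 0 * g 0 0 * x) = (g * upper x * g^-1)%g.
  by rewrite upper_conj // mulgK.
by rewrite !groupM ?groupV.
Qed.

(* The word [v(phi/2) u(-phi) v(phi) u(phi) v(-phi)] is upper triangular with
   diagonal [(2 + 2 phi, 1 - phi/2)], so conjugation by it sends [u(phi)] to
   [u((2 + 2 phi)^2 phi) = u(12 + 20 phi)]. *)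
Lemma Gamma_mod_upper12 : coprime 2 q -> upper (12%:R : Rq) \in K.
Proof.
move=> c; have [k k2] := coprime_unit q0 c.
have F2 := proj_phi_sqr.
pose w := (lower (f * k%:R) * (upper (f * 1%:R))^-1 * lower (f * 1%:R) *
           upper (f * 1%:R) * (lower (f * 1%:R))^-1)%g.
have Kw : w \in K by rewrite !groupM ?groupV ?Gamma_mod_upper ?Gamma_mod_lower.
have w00 : SL2val w 0 0 = 2%:R + 2%:R * f.
  by rewrite /w -upperN -lowerN /= !mulmx2 !mxE /=; ring: F2.
have w10 : SL2val w 1 0 = 0.
  transitivity ((2%:R * f + 1) * (k%:R * 2%:R - 1)); last by rewrite k2 subrr mulr0.
  by rewrite /w -upperN -lowerN /= !mulmx2 !mxE /=; ring: F2.
have := Gamma_mod_upper_conj Kw w10 (Gamma_mod_upper 1).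
rewrite w00 => Ku.
have -> : upper (12%:R : Rq) = ((upper (f * 20%:R))^-1 *
  upper ((2%:R + 2%:R * f) * (2%:R + 2%:R * f) * (f * 1%:R))%R)%g.
  by rewrite -upperN -upperD; congr upper; ring: F2.
by rewrite groupM // groupV Gamma_mod_upper.
Qed.

(* Same argument with [v(2 phi/3) u(-phi) v(phi) u(-4 phi) v(phi)], of diagonal
   [(3 + 6 phi, -1 + 2 phi/3)], and [(3 + 6 phi)^2 phi = 72 + 117 phi]. *)
Lemma Gamma_mod_upper72 : coprime 3 q -> upper (72%:R : Rq) \in K.
Proof.
move=> c; have [k k3] := coprime_unit q0 c.
have F2 := proj_phi_sqr.
pose w := (lower (f * (2 * k)%N%:R) * (upper (f * 1%:R))^-1 * lower (f * 1%:R) *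
           (upper (f * 4%:R))^-1 * lower (f * 1%:R))%g.
have Kw : w \in K by rewrite !groupM ?groupV ?Gamma_mod_upper ?Gamma_mod_lower.
have w00 : SL2val w 0 0 = 3%:R + 6%:R * f.
  by rewrite /w -!upperN /= !mulmx2 !mxE /=; ring: F2.
have w10 : SL2val w 1 0 = 0.
  transitivity ((6%:R * f + 4%:R) * (k%:R * 3%:R - 1)); last by rewrite k3 subrr mulr0.
  by rewrite /w -!upperN /= !mulmx2 !mxE /=; ring: F2.
have := Gamma_mod_upper_conj Kw w10 (Gamma_mod_upper 1).
rewrite w00 => Ku.
have -> : upper (72%:R : Rq) = ((upper (f * 117%:R))^-1 *
  upper ((3%:R + 6%:R * f) * (3%:R + 6%:R * f) * (f * 1%:R))%R)%g.
  by rewrite -upperN -upperD; congr upper; ring: F2.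
by rewrite groupM // groupV Gamma_mod_upper.
Qed.

(** Powers of [upper d] give the integer multiples of [d], and powers of A those of [d * phi]; one
    integral unipotent thus yields the whole ideal. *)
Lemma Gamma_mod_upper_ideal d : upper (d%:R : Rq) \in K ->
  forall z : Zphi, upper (d%:R * Zphi_proj q z) \in K.
Proof.
move=> Kd z; have [a [b ->]] := ZphiP z.
rewrite rmorphD (rmorphM _ b%:~R) !rmorph_int mulrDr upperD groupM ?group_upperMz //.
rewrite [_ * f]mulrC mulrA; apply: group_upperMz.
by rewrite mulrC Gamma_mod_upper.
Qed.

Lemma Gamma_mod_upper_unit d c : upper ((d * c)%N%:R : Rq) \in K -> coprime c q ->
  upper (d%:R : Rq) \in K.
Proof.
move=> Kd cq; have [k kc] := coprime_unit q0 cq.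
have -> : d%:R = ((d * c)%N%:R : Rq) * k%:R.
  by rewrite natrM -mulrA [c%:R * _]mulrC kc mulr1.
by rewrite mulr_natr upperMn groupX.
Qed.

End Local.

(** * Elementary generation modulo prime powers *)

Definition Znorm (a b : int) : int := a * a + a * b - b * b.

(** The inverse is the conjugate divided by the norm; an extra factor of the norm makes the
    denominator a square, a natural number to which [coprime_unit] applies. *)
Lemma Znorm_unit q (a b : int) : (0 < q)%N -> coprime `|Znorm a b|%N q ->
  exists w : Zphi_mod q, w * Zphi_proj q (a%:~R + b%:~R * phiZ) = 1.
Proof.
move=> q0 /(coprimeXl 2) c; have [k kN] := coprime_unit q0 c.
have NN : Zphi_proj q ((Znorm a b)%:~R * (Znorm a b)%:~R) = (`|Znorm a b| ^ 2)%N%:R.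
  rewrite -rmorphM rmorph_int pmulrn; congr (_ *~ _).
  by move: (Znorm a b) => N; nia.
exists (k%:R * Zphi_proj q ((Znorm a b)%:~R * (a%:~R + b%:~R - b%:~R * phiZ))).
rewrite -mulrA -rmorphM; set y := (_ * _ * _).
suff -> : y = (Znorm a b)%:~R * (Znorm a b)%:~R by rewrite /= NN kN.
by rewrite /y /Znorm !(rmorphD, rmorphN, rmorphM) /=; ring: phiZ_sqr.
Qed.

(* [a'] and [c'] stand for the conjugates of [a] and [c], so that [a a'] and [c c']
   are norms and [a c' + a' c] is a trace. *)
Lemma isotropic_pair_eq0 (R : comPzRingType) (a b c d a' c' : R) :
  a * d - b * c = 1 -> a * a' = 0 -> c * c' = 0 -> a * c' + a' * c = 0 ->
  a' = 0 /\ c' = 0.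
Proof.
move=> D aa cc T; set w := a * c'.
have aw : a' = b * w.
  have -> : b * w = b * (a * c' + a' * c) - d * (a * a') + a' * (a * d - b * c).
    by rewrite /w; ring.
  by rewrite T aa D !mulr0 mulr1 subr0 add0r.
have cw : c' = w * d.
  have -> : w * d = c' * (a * d - b * c) + b * (c * c') by rewrite /w; ring.
  by rewrite D cc mulr0 mulr1 addr0.
suff w0 : w = 0 by rewrite aw cw w0 mulr0 mul0r.
have bcw : b * c * w = 0.
  have -> : b * c * w = b * a * (c * c') by rewrite /w; ring.
  by rewrite cc mulr0.
have -> : w = (a * c' + a' * c) - b * c * w.
  by rewrite [in LHS]/w aw; ring.
by rewrite T bcw subr0.
Qed.

(** This is the inertness of 2 in Z[phi]. *)
Lemma dvd2_Znorm (a b : int) : (2 %| Znorm a b)%Z -> (2 %| a)%Z && (2 %| b)%Z.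
Proof.
rewrite /Znorm => /dvdzP[k E].
have [u ua] : exists u, a = 2 * u \/ a = 2 * u + 1 by exists (a %/ 2)%Z; lia.
have [v vb] : exists v, b = 2 * v \/ b = 2 * v + 1 by exists (b %/ 2)%Z; lia.
have : (a = 2 * u /\ b = 2 * v).
  by case: ua vb E => -> [] -> E; split=> //; lia.
by move=> [-> ->]; rewrite !dvdz_mulr.
Qed.

(** The norm is quadratic in [j], its middle coefficient being the trace of one element times the
    conjugate of the other; the values at 0, 1, 2 determine the coefficients up to a factor 2. *)
Lemma dvd_Znorms p (a b c d : int) : prime p ->
  (forall j : nat, (p %| Znorm (a + j%:Z * c) (b + j%:Z * d))%Z) ->
  [/\ (p %| Znorm a b)%Z, (p %| Znorm c d)%Z &
      (p %| 2 * (a * c) + a * d + b * c - 2 * (b * d))%Z].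
Proof.
move=> pp H; have N0 : (p %| Znorm a b)%Z by have := H 0%N; rewrite !mul0r !addr0.
set T := (X in [/\ _, _ & (_ %| X)%Z]).
have E j : Znorm (a + j%:Z * c) (b + j%:Z * d) =
    Znorm a b + (j%:Z * T + j%:Z * j%:Z * Znorm c d).
  by rewrite /Znorm /T; ring.
have D j : (p %| j%:Z * T + j%:Z * j%:Z * Znorm c d)%Z.
  by have := H j; rewrite E rpredDl.
(* At 2 that factor is not invertible, but inertness makes [a] and [b] even, hence [T] too. *)
have [p2|p2] := eqVneq p 2%N.
  subst p; have /andP[/dvdzP[u ua] /dvdzP[v vb]] := dvd2_Znorm N0.
  have T2 : (2 %| T)%Z.
    apply/dvdzP; exists (a * c + u * d + v * c - b * d); rewrite /T ua vb; ring.
  by split=> //; have := D 1%N; rewrite !mul1r rpredDl.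
have D1 : (p %| T + Znorm c d)%Z by have := D 1%N; rewrite !mul1r.
have D2 : (p %| 2 * Znorm c d)%Z.
  have -> : 2 * Znorm c d =
      (2%:Z * T + 2%:Z * 2%:Z * Znorm c d) - 2 * (T + Znorm c d) by ring.
  by rewrite rpredB ?dvdz_mull.
have Nc : (p %| Znorm c d)%Z.
  by rewrite -(@Gauss_dvdzr _ 2) // coprimezE prime_coprime // dvdn_prime2.
by split=> //; rewrite -(addrK (Znorm c d) T) rpredB.
Qed.

Lemma Zphi_modP q (x : Zphi_mod q) :
  exists a b : int, x = Zphi_proj q (a%:~R + b%:~R * phiZ).
Proof.
have [a [b E]] := ZphiP (generic_quotient.repr x).
by exists a, b; rewrite -E Zphi_proj_repr.
Qed.

(** The residue ring modulo [p] need not be a field. If no integer [x] works, the norms of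
    [g 0 0 + j * g 1 0] all vanish modulo [p], and [isotropic_pair_eq0] forces the first column to
    vanish modulo [p], against determinant 1. *)
Lemma SL2mod_unit_entry p e (g : SL2mod (p ^ e.+1)) : prime p ->
  exists x w, w * (g 0 0 + x * g 1 0) = 1.
Proof.
move=> pp; have p0 := prime_gt0 pp; set q := (p ^ e.+1)%N in g *.
have q0 : (0 < q)%N by rewrite expn_gt0 p0.
have [a1 [a2 aE]] := Zphi_modP (g 0 0); have [c1 [c2 cE]] := Zphi_modP (g 1 0).
pose N j := Znorm (a1 + j%:Z * c1) (a2 + j%:Z * c2).
have [/existsNP[j Nj]|H] := pselect (~ forall j, (p %| N j)%Z).
  have co : coprime `|N j|%N q.
    by rewrite coprime_sym coprime_pexpl // prime_coprime //; apply/negP.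
  have [w wE] := Znorm_unit q0 co; exists (Zphi_proj q j%:R), w.
  rewrite -wE; congr (_ * _).
  rewrite aE cE -rmorphM -rmorphD; congr Zphi_proj.
  by rewrite !(rmorphD, rmorphM) /=; ring.
have {}H : forall j, (p %| N j)%Z by apply: contrapT.
have [Na Nc T] := dvd_Znorms pp H.
have dvd0 (m : int) : (p %| m)%Z -> Zphi_proj p m%:~R = 0.
  move=> pm; have := Zphi_proj_eq0 m 0 p0.
  by rewrite mul0r addr0 pm dvdz0 => /eqP.
have [b1 [b2 bE]] := Zphi_modP (g 0 1); have [d1 [d2 dE]] := Zphi_modP (g 1 1).
have D : Zphi_proj p (a1%:~R + a2%:~R * phiZ) * Zphi_proj p (d1%:~R + d2%:~R * phiZ) -
         Zphi_proj p (b1%:~R + b2%:~R * phiZ) * Zphi_proj p (c1%:~R + c2%:~R * phiZ) = 1.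
  apply/subr0_eq; rewrite -!rmorphM -rmorphB -[X in _ - X](rmorph1 (Zphi_proj p)) -rmorphB.
  apply: (@Zphi_proj_dvd p q); rewrite ?dvdn_exp //.
  rewrite !(rmorphB, rmorphM) rmorph1 /= -aE -bE -cE -dE SL2_det; exact: subrr.
have := isotropic_pair_eq0 (a' := Zphi_proj p (a1%:~R + a2%:~R - a2%:~R * phiZ))
  (c' := Zphi_proj p (c1%:~R + c2%:~R - c2%:~R * phiZ)) D.
rewrite -!(rmorphM (Zphi_proj p)) -(rmorphD (Zphi_proj p)) /= => /(_ _ _ _)[].
- rewrite -[RHS](dvd0 _ Na); congr Zphi_proj.
  by rewrite /Znorm !(rmorphD, rmorphN, rmorphM) /=; ring: phiZ_sqr.
- rewrite -[RHS](dvd0 _ Nc); congr Zphi_proj.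
  by rewrite /Znorm !(rmorphD, rmorphN, rmorphM) /=; ring: phiZ_sqr.
- rewrite -[RHS](dvd0 _ T); congr Zphi_proj.
  by rewrite !(rmorphD, rmorphN, rmorphM) /=; ring: phiZ_sqr.
have coord (x y : int) : Zphi_proj p (x%:~R + y%:~R - y%:~R * phiZ) = 0 ->
    Zphi_proj p (x%:~R + y%:~R * phiZ) = 0.
  have -> : x%:~R + y%:~R - y%:~R * phiZ = (x + y)%:~R + (- y)%:~R * phiZ.
    by rewrite rmorphD rmorphN mulNr.
  move=> /eqP; rewrite Zphi_proj_eq0 // => /andP[pxy py'].
  have py : (p %| y)%Z by rewrite -[y]opprK rpredN.
  have px : (p %| x)%Z by rewrite -(addrK y x) rpredB.
  by apply/eqP; rewrite Zphi_proj_eq0 // px py.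
move=> /coord a0 /coord c0; move: D; rewrite a0 c0 mul0r mulr0 subr0 => D.
have := Zphi_proj_eq0 1 0 p0.
rewrite mul0r addr0 !rmorph1 -D eqxx dvdz1 => /esym/andP[/eqP /= p1 _].
by rewrite p1 in pp.
Qed.

(** An upper unipotent first makes the corner a unit; then [SL2_factor] applies with [s = 1]. *)
Lemma SL2mod_elementary p e (K : {group SL2mod (p ^ e.+1)}) : prime p ->
  (forall x, upper x \in K) -> (forall x, lower x \in K) -> forall g, g \in K.
Proof.
move=> pp Ku Kl g; have [x [w wE]] := SL2mod_unit_entry g pp.
rewrite -(groupMl _ (Ku x)); set h := (_ * g)%g.
have h00 : SL2val h 0 0 = g 0 0 + x * g 1 0.
  by rewrite /h /= [X in _ *m X]mx2_eta mulmx2 !mxE /= mul1r.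
rewrite -h00 in wE; have st : SL2val h 0 0 = 1 + 1 * (SL2val h 0 0 - 1) by ring.
by rewrite (SL2_factor wE st) !groupM.
Qed.

Section LocalKernel.
Variables (q d k : nat).
Hypotheses (q0 : (0 < q)%N) (d0 : (0 < d)%N) (qdk : (q %| d ^ k)%N).
Hypothesis Kd : upper (d%:R : Zphi_mod q) \in Gamma_mod q.

(* For [g = 1] mod [d] the top-left entry is [1 + s t] with [s = phi] and
   [t = d x / phi], [1 / phi = phi - 1]; hence only multiples of [d], besides
   [phi], occur in the factors of [SL2_factor]. *)
Lemma Gamma_mod_kernel g : reduce d g = 1%g -> reduce q g \in Gamma_mod q.
Proof.
rewrite -(reduce1 d) => /reduceP E.
have ex i j : exists z, g i j = (1%:M : 'M_2) i j + d%:R * z.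
  have := E i j; rewrite -(rmorph0 (Zphi_proj d)) => /eqP/Zphi_projP[z].
  by rewrite prednK // subr0 => zE; exists z; rewrite -zE addrC subrK.
have Ku (z : Zphi_mod q) : upper (d%:R * z) \in Gamma_mod q.
  by rewrite -(Zphi_proj_repr z) Gamma_mod_upper_ideal.
have Kl (z : Zphi_mod q) : lower (d%:R * z) \in Gamma_mod q.
  exact: Gamma_mod_lower_upper.
pose f := Zphi_proj q phiZ; have F2 : f * f = f + 1 := proj_phi_sqr q.
have Kf : upper f \in Gamma_mod q by have := Gamma_mod_upper q 1; rewrite mulr1.
have [x xE] := ex 0 0; have [y yE] := ex 0 1; have [z zE] := ex 1 0.
rewrite !mxE /= in xE yE zE.
pose X := Zphi_proj q x; pose Y := Zphi_proj q y; pose Z := Zphi_proj q z.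
have gE i j : SL2val (reduce q g) i j = Zphi_proj q (g i j) by rewrite mxE.
have g00 : SL2val (reduce q g) 0 0 = 1 + f * (d%:R * (X * (f - 1))).
  rewrite gE xE rmorphD rmorphM rmorph1 rmorph_nat -/X; ring: F2.
have g01 : SL2val (reduce q g) 0 1 = d%:R * Y.
  by rewrite gE yE add0r rmorphM rmorph_nat.
have g10 : SL2val (reduce q g) 1 0 = d%:R * Z.
  by rewrite gE zE add0r rmorphM rmorph_nat.
(* The corner is 1 modulo [d], so its norm is prime to [d], hence to [q], which divides a power of
   [d]. *)
have [w wE] : exists w, w * SL2val (reduce q g) 0 0 = 1.
  rewrite gE xE; have [a [b ->]] := ZphiP x.
  have -> : 1%N%:R + d%:R * (a%:~R + b%:~R * phiZ) =
      (1 + d%:Z * a)%:~R + (d%:Z * b)%:~R * phiZ :> Zphi.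
    by rewrite !(rmorphD, rmorphM) /=; ring.
  apply: Znorm_unit => //; apply: (coprime_dvdr qdk); apply: coprimeXr.
  have -> : Znorm (1 + d%:Z * a) (d%:Z * b) =
     1 + d%:Z * (2 * a + b + d%:Z * Znorm a b) by rewrite /Znorm; ring.
  rewrite -[coprime _ _]/(coprimez _ d%:Z) coprimez_sym.
  by rewrite /coprimez addrC mulrC gcdzMDl gcdz1.
have wd : w * d%:R * X = 1 - w.
  by rewrite -[in RHS]wE g00; ring: F2.
rewrite (SL2_factor wE g00) g01 g10.
(* By [wd], [w] is 1 modulo [d]: the exponent is [- f] plus a multiple of [d], and both unipotents
   are available. *)
have -> : w * (d%:R * Y - f) = d%:R * (w * Y + X * w * f) - f.
  have -> : w * (d%:R * Y - f) = d%:R * w * Y - w * f by ring.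
  by rewrite -[X in _ - X * f](subKr 1) -wd; ring.
have -> : w * (d%:R * Z - d%:R * (X * (f - 1))) = d%:R * (w * (Z - X * (f - 1))).
  by ring.
by rewrite upperD upperN !groupM ?groupV.
Qed.
End LocalKernel.

(** * Prime powers and gluing *)

Lemma Gamma_mod_full p e (g : SL2mod (p ^ e.+1)) : prime p -> (3 < p)%N ->
  g \in Gamma_mod (p ^ e.+1).
Proof.
move=> pp p3; have q0 : (0 < p ^ e.+1)%N by rewrite expn_gt0 prime_gt0.
have cop r : (r < p)%N -> (0 < r)%N -> coprime r (p ^ e.+1).
  move=> rp r0; rewrite coprime_sym coprime_pexpl // prime_coprime //.
  by rewrite gtnNdvd.
have K12 := Gamma_mod_upper12 q0 (cop 2 (ltnW p3) isT).
have c12 : coprime 12 (p ^ e.+1).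
  by rewrite -[12%N]/(2 * 2 * 3)%N !coprimeMl !cop // ltnW.
have K1 := Gamma_mod_upper_unit (d := 1) (c := 12) q0 K12 c12.
have Ku x : upper x \in Gamma_mod (p ^ e.+1).
  rewrite -(Zphi_proj_repr x) -[X in upper X]mul1r.
  exact: (Gamma_mod_upper_ideal K1).
by apply: SL2mod_elementary => // x; apply: Gamma_mod_lower_upper.
Qed.

Lemma Gamma_mod_kernel3 e g : reduce 3 g = 1%g ->
  reduce (3 ^ e) g \in Gamma_mod (3 ^ e).
Proof.
have q0 : (0 < 3 ^ e)%N by rewrite expn_gt0.
apply: (Gamma_mod_kernel (k := e)) => //.
apply: (@Gamma_mod_upper_unit _ q0 3 4); last by rewrite coprimeXr.
by apply: Gamma_mod_upper12; rewrite // coprimeXr.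
Qed.

Lemma Gamma_mod_kernel8 e g : reduce 8 g = 1%g ->
  reduce (2 ^ e) g \in Gamma_mod (2 ^ e).
Proof.
have q0 : (0 < 2 ^ e)%N by rewrite expn_gt0.
apply: (Gamma_mod_kernel (k := e)) => //.
  by rewrite -[8%N]/(2 ^ 3)%N -expnM dvdn_exp2l // leq_pmull.
apply: (@Gamma_mod_upper_unit _ q0 8 9); last by rewrite coprimeXr.
by apply: Gamma_mod_upper72; rewrite // coprimeXr.
Qed.

(* A word congruent to [u(4)] mod 8, found by computer search. *)
Definition upper4_word : SL2 Zphi :=
  (upper phiZ * lower phiZ ^+ 2 * upper phiZ ^+ 2 * lower phiZ ^+ 2 *
   (upper phiZ)^-1 ^+ 3 * lower phiZ ^+ 4)%g.

Lemma Gamma_upper4_word : upper4_word \in Gamma.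
Proof.
have GG := Gamma_group_closed; have GM := group_closedM GG.
have GV := group_closedV GG; have [GA GB] := (Gamma_A, Gamma_B).
by rewrite /upper4_word -matA_upper -matB_lower !GM ?group_closedX ?GV.
Qed.

Lemma reduce8_upper4_word : reduce 8 (upper4_word * upper (- 4%:R))%g = 1%g.
Proof.
(* The exact product over Z[phi], written so that its difference from the identity is visibly
   divisible by 8. *)
have wE : SL2val (upper4_word * upper (- 4%:R))%g = mx2
    (1 - 8%:R * (77%:R + 122%:R * phiZ)) (8%:R * (296%:R + 468%:R * phiZ))
    (- (8%:R * (39%:R + 65%:R * phiZ))) (1 + 8%:R * (149%:R + 250%:R * phiZ)).
  rewrite /upper4_word -upperN -!upperMn -!lowerMn /= !mulmx2.
  by congr mx2; ring: phiZ_sqr.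
move: (_ * _)%g wE => w wE; have proj8 (z : Zphi) : Zphi_proj 8 (8%:R * z) = 0.
  by rewrite rmorphM rmorph_nat Zphi_proj_nat0 // mul0r.
apply: val_inj => /=; rewrite wE mx2_1 [LHS]mx2_eta !mxE /=.
by rewrite rmorphB rmorphD rmorphN /= !proj8 rmorph1 subr0 addr0 oppr0.
Qed.

(** The word and [upper 4] differ by an element trivial modulo 8, which [Gamma_mod_kernel8] places
    in the image; this lowers the level from 8 to 4. *)
Lemma Gamma_mod_upper4 e : upper (4%:R : Zphi_mod (2 ^ e)) \in Gamma_mod (2 ^ e).
Proof.
have Kw : reduce (2 ^ e) upper4_word \in Gamma_mod (2 ^ e).
  exact: mem_image_mod Gamma_upper4_word.
have := Gamma_mod_kernel8 e reduce8_upper4_word.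
rewrite reduceM (groupMl _ Kw) reduce_upper rmorphN rmorph_nat upperN.
by rewrite groupV.
Qed.

Lemma Gamma_mod_kernel4 e g : reduce 4 g = 1%g ->
  reduce (2 ^ e) g \in Gamma_mod (2 ^ e).
Proof.
apply: (Gamma_mod_kernel (k := e)); rewrite ?expn_gt0 //.
  by rewrite -[4%N]/(2 ^ 2)%N -expnM dvdn_exp2l // leq_pmull.
exact: Gamma_mod_upper4.
Qed.

Lemma Gamma_mod_local q p g : (0 < q)%N -> p \in primes q ->
  reduce (gcdn q 12) g = 1%g ->
  reduce (p ^ logn p q) g \in Gamma_mod (p ^ logn p q).
Proof.
move=> q0 pq; rewrite -{1}(reduce1 (gcdn q 12)) => E.
have g0 : (0 < gcdn q 12)%N by rewrite gcdn_gt0 q0.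
have [pp e0] : prime p /\ (0 < logn p q)%N.
  by rewrite logn_gt0 pq; move: pq; rewrite mem_primes => /andP[].
have [p3|] := ltnP 3 p.
  by case: (logn p q) e0 => // e _; apply: Gamma_mod_full.
have dq : (p ^ logn p q %| q)%N by apply: pfactor_dvdnn.
case: p pp e0 dq {pq} => [|[|[|[|]]]] // pp e0 dq _.
  (* If 2 divides [q] exactly once, 4 does not divide the gcd, but the modulus is then 2, where [g]
     is already trivial. *)
  have [e1|e1] := eqVneq (logn 2 q) 1%N.
    rewrite e1 in dq *; rewrite (reduce_dvd (h := 1%g) _ g0 E) ?reduce1 ?group1 //.
    by rewrite dvdn_gcd dq.
  apply: Gamma_mod_kernel4; rewrite (reduce_dvd (h := 1%g) _ g0 E) ?reduce1 //.
  rewrite dvdn_gcd andbT; apply: dvdn_trans dq.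
  by rewrite -[4%N]/(2 ^ 2)%N dvdn_exp2l // ltn_neqAle eq_sym e1.
apply: Gamma_mod_kernel3; rewrite (reduce_dvd (h := 1%g) _ g0 E) ?reduce1 //.
rewrite dvdn_gcd andbT; apply: dvdn_trans dq.
by rewrite -[X in (X %| _)%N]expn1 dvdn_exp2l.
Qed.

(** Each local component of [g] comes from Gamma; the glued element agrees with [g] modulo [q],
    hence modulo the gcd, where it is trivial. *)
Lemma image_mod_ker q : (0 < q)%N ->
  image_mod q (Gamma_ker (gcdn q 12)) = image_mod q (G_ker (gcdn q 12)).
Proof.
move=> q0; apply/setP => x; apply/idP/idP => /image_modP[g].
  by move=> /andP[_ gK] <-; apply: mem_image_mod.
move=> gK <-; have E := eqP gK.
have ex p : exists h, p \in primes q -> h \in Gamma /\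
    reduce (p ^ logn p q) h = reduce (p ^ logn p q) g.
  have [pq|pq] := boolP (p \in primes q); last by exists 1%g.
  have /image_modP[h hG hE] := Gamma_mod_local q0 pq E.
  by exists h.
have [y yP] := choice ex.
have [h hG hE] := Gamma_glue q0 (fun p pq => (yP p pq).1).
have qE : reduce q h = reduce q g.
  by apply: reduce_parts => // p pq; rewrite hE // (yP p pq).2.
rewrite -qE; apply: mem_image_mod; apply/andP; split=> //.
apply/eqP; rewrite -[RHS]E.
exact: (reduce_dvd (dvdn_gcdl _ _) q0 qE).
Qed.

Section Transfer.
Variables (q m : nat).

(* [reduce q] need not be known to be onto, hence the default value. *)
Definition transfer (x : SL2mod q) : SL2mod m :=
  if pselect (exists g, reduce q g = x) is left h then reduce m (projT1 (cid h))
  else 1%g.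

Lemma transfer_reduce g : (0 < q)%N -> (m %| q)%N ->
  transfer (reduce q g) = reduce m g.
Proof.
move=> q0 mq; rewrite /transfer; case: pselect => [h|[]]; last by exists g.
by case: (cid h) => /= k /(reduce_dvd mq q0).
Qed.
End Transfer.

(** Injectivity comes from [reduce_parts], surjectivity from [Gamma_glue]. *)
Lemma Gamma_mod_prod q : (0 < q)%N -> exists f : SL2mod q -> SL2prod q,
  (forall g (p : seq_sub (primes q)), f (reduce q g) p = reduce (ppart p) g)
  /\ misom (Gamma_mod q) (Gamma_prod q) f.
Proof.
move=> q0; pose f (x : SL2mod q) : SL2prod q :=
  [ffun p : seq_sub (primes q) => transfer (ppart p) x].
have fE g p : f (reduce q g) p = reduce (ppart p) g.
  by rewrite ffunE transfer_reduce // pfactor_dvdnn.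
exists f; split=> //.
have fM : {in Gamma_mod q &, {morph f : x y / (x * y)%g}}.
  move=> _ _ /image_modP[g _ <-] /image_modP[h _ <-].
  apply/ffunP => p; rewrite -reduceM fE reduceM !ffunE !transfer_reduce //;
    exact: pfactor_dvdnn.
apply/misomP; exists (introT morphicP fM); apply/isomP; split.
  apply/injmP => _ _ /image_modP[g _ <-] /image_modP[h _ <-]; rewrite /= !morphmE => E.
  apply: reduce_parts => // p pq.
  by have := congr1 (fun y : SL2prod q => y (SeqSub pq)) E; rewrite !fE.
apply/setP => y; rewrite morphimEdom; apply/imsetP/setXnP => [[x Gx ->] p|Hy].
  have /image_modP[g gG <-] := Gx; rewrite /= morphmE fE; exact: mem_image_mod.
(* [Gamma_glue] is indexed by natural numbers, so a lift is chosen for every [p], with default 1 off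
   the primes of [q]. *)
have ex p : exists h, forall pq : p \in primes q,
    h \in Gamma /\ reduce (ppart (SeqSub pq)) h = y (SeqSub pq).
  have [pq|npq] := pselect (p \in primes q); last first.
    by exists 1%g => pq; case: (npq pq).
  have /image_modP[h hG hE] := Hy (SeqSub pq); exists h => pq'.
  by rewrite (bool_irrelevance pq' pq).
have [z zP] := choice ex.
have [g gG gE] := Gamma_glue q0 (fun p pq => (zP p pq).1).
exists (reduce q g); first exact: mem_image_mod.
apply/ffunP => -[p pq]; rewrite /= morphmE fE -(zP p pq).2.
by rewrite -(gE p pq).
Qed.

(** * Index modulo 12 *)

Lemma index_reps (gT : finGroupType) (G H : {group gT}) (T : eqType)
    (s : seq T) (r : T -> gT) : H \subset G -> uniq s ->
  (forall i, i \in s -> r i \in G) ->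
  {in s &, forall i j, r i * (r j)^-1 \in H -> i = j}%g ->
  (forall x, x \in G -> exists2 i, i \in s & x * (r i)^-1 \in H)%g ->
  #|G : H|%g = size s.
Proof.
move=> HG us rG rI cov; rewrite -(size_map (fun i => H :* r i)%g s).
have inj : {in s &, injective (fun i => H :* r i)%g}.
  by move=> i j si sj /= E; apply: rI => //; rewrite -mem_rcoset -E rcoset_refl.
rewrite -(card_uniqP _) ?map_inj_in_uniq //; apply: eq_card => A.
apply/rcosetsP/mapP => [[x xG ->]|[i si ->]]; last by exists (r i); rewrite ?rG.
have [i si xi] := cov x xG; exists i => //.
by apply: rcoset_eqP; rewrite mem_rcoset.
Qed.

Lemma stabilizer_group_set (gT : finGroupType) (X : {set gT}) :
  group_set [set g | X :* g \subset X]%g.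
Proof.
apply/group_setP; split=> [|g h]; first by rewrite inE rcoset1.
rewrite !inE rcosetM => gX hX; apply: subset_trans hX.
by rewrite mulSg.
Qed.

(** [X] need not be a group, but its right stabilizer is one, inverses being automatic in a finite
    group; as 1 lies in [X], the stabilizer is contained in [X]. *)
Lemma gen_subset_stable (gT : finGroupType) (A X : {set gT}) : 1%g \in X ->
  (forall x g, x \in X -> g \in A -> (x * g)%g \in X) -> <<A>>%g \subset X.
Proof.
move=> X1 XA; apply/subsetP => g gA.
have : g \in Group (stabilizer_group_set X).
  apply: (subsetP _ g gA); rewrite gen_subG; apply/subsetP => a aA.
  rewrite inE; apply/subsetP => _ /rcosetP[x xX ->]; exact: XA.
by rewrite inE => /subsetP; apply; rewrite mem_rcoset mulgV.
Qed.

(** The kernel of reduction modulo 4 maps onto everything modulo 3: its image contains all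
    unipotents, and these generate. *)
Lemma fullG_isolates34 : isolates 3 4 fullG.
Proof.
move=> g _; have KC : group_closed (G_ker 4).
  split=> [|x y /eqP xK /eqP yK]; apply/eqP; first exact: reduce1.
  by rewrite reduceM reduceV xK yK mulgV.
suff : reduce 3 g \in Group (@image_mod_group_set 3 _ KC).
  by move=> /image_modP[h /eqP h4 h3]; exists h.
have Ku x : upper x \in Group (@image_mod_group_set 3 _ KC).
  rewrite -(Zphi_proj_repr x) -reduce_upper.
  have [//|//|//|//|h _ [<- h4]] :=
    @upper_isolated 3 4 (generic_quotient.repr x) fullG fullG_group_closed.
  by apply: mem_image_mod; apply/eqP.
have Kl x : lower x \in Group (@image_mod_group_set 3 _ KC).
  rewrite -(Zphi_proj_repr x) -reduce_lower.
  have [//|//|//|//|h _ [<- h4]] :=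
    @lower_isolated 3 4 (generic_quotient.repr x) fullG fullG_group_closed.
  by apply: mem_image_mod; apply/eqP.
exact: (@SL2mod_elementary 3 0).
Qed.

Lemma card_image_mod_coprime m n (H : {pred SL2 Zphi}) : group_closed H ->
  (0 < m)%N -> (0 < n)%N -> coprime m n -> isolates m n H ->
  #|image_mod (m * n) H| = (#|image_mod m H| * #|image_mod n H|)%N.
Proof.
move=> gH m0 n0 mn iso; have mn0 : (0 < m * n)%N by rewrite muln_gt0 m0.
pose F (x : SL2mod (m * n)) : SL2mod m * SL2mod n := (transfer m x, transfer n x).
have FE g : F (reduce (m * n) g) = (reduce m g, reduce n g).
  rewrite /F (transfer_reduce g mn0 (dvdn_mulr n (dvdnn m))).
  by rewrite (transfer_reduce g mn0 (dvdn_mull m (dvdnn n))).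
have Finj : {in image_mod (m * n) H &, injective F}.
  move=> _ _ /image_modP[g _ <-] /image_modP[h _ <-]; rewrite !FE => E.
  exact: reduce_coprime m0 n0 mn (congr1 fst E) (congr1 snd E).
rewrite -(card_in_imset Finj) -cardsX; apply: eq_card => -[x y]; rewrite in_setX.
apply/imsetP/andP => [[_ /image_modP[g gG <-]]|].
  rewrite FE => E; have /= -> := congr1 fst E; have /= -> := congr1 snd E.
  by rewrite !mem_image_mod.
move=> [/image_modP[g gG <-] /image_modP[h hG <-]].
have [a aG [am an]] := iso g gG; have [b bG [bm bn]] := iso h hG.
have HM := group_closedM gH; have HV := group_closedV gH.
(* One-sided isolation is enough: [a] has image (g, 1) and [b^-1 * h] has image (1, h). *)
exists (reduce (m * n) (a * (b^-1 * h))%g).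
  by apply: mem_image_mod; apply: (HM) => //; apply: (HM) => //; apply: HV.
by rewrite FE !reduceM !reduceV am an bm bn mulVg mulg1 invg1 !mul1g.
Qed.

(* Matrices over [Z[phi]/n], entries [a + b phi] being pairs of residues. *)
Definition zphi_code : Type := nat * nat.
Definition mx_code : eqType :=
  (nat * nat * (nat * nat) * (nat * nat) * (nat * nat))%type.

Section Codes.
Variable n : nat.

Definition addc (x y : zphi_code) : zphi_code :=
  ((x.1 + y.1) %% n, (x.2 + y.2) %% n)%N.
(** Truncated subtraction gives an opposite only for coordinates at most [n]; that [invmxc] inverts
    is verified on each representative by [coset_check]. *)
Definition oppc (x : zphi_code) : zphi_code :=
  ((n - x.1) %% n, (n - x.2) %% n)%N.
Definition mulc (x y : zphi_code) : zphi_code :=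
  ((x.1 * y.1 + x.2 * y.2) %% n,
   (x.1 * y.2 + x.2 * y.1 + x.2 * y.2) %% n)%N.

Definition mulmxc (M N : mx_code) : mx_code :=
  let: (a, b, c, d) := M in let: (a', b', c', d') := N in
  (addc (mulc a a') (mulc b c'), addc (mulc a b') (mulc b d'),
   addc (mulc c a') (mulc d c'), addc (mulc c b') (mulc d d')).
Definition invmxc (M : mx_code) : mx_code :=
  let: (a, b, c, d) := M in (d, oppc b, oppc c, a).
Definition onec : mx_code := ((1, 0), (0, 0), (0, 0), (1, 0))%N.
Definition upperc (x : zphi_code) : mx_code := ((1, 0)%N, x, (0, 0)%N, (1, 0)%N).
Definition lowerc (x : zphi_code) : mx_code := ((1, 0)%N, (0, 0)%N, x, (1, 0)%N).
Definition det1c (M : mx_code) : bool :=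
  let: (a, b, c, d) := M in mulc a d == addc (mulc b c) (1, 0)%N.
Definition reducedc (M : mx_code) : bool :=
  let: (a, b, c, d) := M in
  all (fun x : nat * nat => (x.1 < n) && (x.2 < n))%N [:: a; b; c; d].

Definition gensc : seq mx_code := [:: upperc (0, 1)%N; lowerc (0, 1)%N].
(** Breadth-first search: [L] holds what has been found, [F] the last layer. The fuel [k] may run
    out early; closure of the result is checked in [coset_check]. *)
Fixpoint closurec (gens : seq mx_code) k (L F : seq mx_code) : seq mx_code :=
  if k is k'.+1 then
    let N := undup [seq M <- flatten [seq [seq mulmxc M g | g <- gens] | M <- F]
                   | M \notin L] in
    closurec gens k' (L ++ N) N
  else L.

Hypothesis n0 : (0 < n)%N.
Local Notation Rn := (Zphi_mod n).

Definition decode (x : zphi_code) : Rn :=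
  Zphi_proj n (x.1%:R + x.2%:R * phiZ).
Definition decodemx (M : mx_code) : 'M[Rn]_2 :=
  let: (a, b, c, d) := M in mx2 (decode a) (decode b) (decode c) (decode d).
(** Codes of determinant other than 1 go to the identity, whence the determinant hypotheses
    below. *)
Definition SL2c (M : mx_code) : SL2mod n := insubd (1%g : SL2mod n) (decodemx M).

Lemma natr_modn (k : nat) : (k %% n)%:R = k%:R :> Rn.
Proof. by rewrite [in RHS](divn_eq k n) natrD natrM Zphi_proj_nat0 // mulr0 add0r. Qed.

Lemma decodeE x : decode x = x.1%:R + x.2%:R * Zphi_proj n phiZ.
Proof. by rewrite /decode rmorphD rmorphM !rmorph_nat. Qed.

Lemma decodeD x y : decode (addc x y) = decode x + decode y.
Proof. by rewrite !decodeE !natr_modn; ring. Qed.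

Lemma decodeM x y : decode (mulc x y) = decode x * decode y.
Proof. by rewrite !decodeE !natr_modn; ring: (proj_phi_sqr n). Qed.

Lemma decodemxM M N : decodemx (mulmxc M N) = decodemx M *m decodemx N.
Proof.
by case: M N => [[[a b] c] d] [[[a' b'] c'] d']; rewrite mulmx2 /= !(decodeD, decodeM).
Qed.

Lemma decode1 : decode (1, 0)%N = 1.
Proof. by rewrite decodeE mul0r addr0. Qed.

Lemma det_decodemx M : det1c M -> \det (decodemx M) == 1.
Proof.
case: M => [[[a b] c] d] /eqP E; rewrite det_mx2 -!decodeM E decodeD decode1.
by rewrite [_ + 1]addrC addrK.
Qed.

Lemma val_SL2c M : \det (decodemx M) == 1 -> SL2val (SL2c M) = decodemx M.
Proof. by move=> dM; rewrite [LHS]val_insubd dM. Qed.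

Lemma det_decodemxM M N : \det (decodemx M) == 1 -> \det (decodemx N) == 1 ->
  \det (decodemx (mulmxc M N)) == 1.
Proof. by rewrite decodemxM det_mulmx => /eqP -> /eqP ->; rewrite mulr1. Qed.

Lemma SL2cM M N : \det (decodemx M) == 1 -> \det (decodemx N) == 1 ->
  SL2c (mulmxc M N) = (SL2c M * SL2c N)%g.
Proof.
move=> dM dN; apply: val_inj => /=.
by rewrite !val_SL2c ?det_decodemxM // decodemxM.
Qed.

Lemma decode_inj x y : (x.1 < n)%N -> (x.2 < n)%N -> (y.1 < n)%N -> (y.2 < n)%N ->
  decode x = decode y -> x = y.
Proof.
case: x y => [a b] [c d] /= an bn cn dn /eqP; rewrite -subr_eq0 /decode -rmorphB.
have -> : (a, b).1%:R + (a, b).2%:R * phiZ - ((c, d).1%:R + (c, d).2%:R * phiZ) =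
   (a%:Z - c%:Z)%:~R + (b%:Z - d%:Z)%:~R * phiZ :> Zphi.
  by rewrite !rmorphB /=; ring.
rewrite Zphi_proj_eq0 // -!eqz_mod_dvd => /andP[/eqP E1 /eqP E2].
by congr pair; move: E1 E2; rewrite !modz_nat !modn_small // => -[? [?]].
Qed.

Lemma SL2c_inj M N : reducedc M -> reducedc N ->
  \det (decodemx M) == 1 -> \det (decodemx N) == 1 -> SL2c M = SL2c N -> M = N.
Proof.
move=> rM rN dM dN /(congr1 (@SL2val _)); rewrite !val_SL2c //.
case: M N rM rN {dM dN} => [[[a b] c] d] [[[a' b'] c'] d'].
move=> /and5P[/andP[? ?] /andP[? ?] /andP[? ?] /andP[? ?] _].
move=> /and5P[/andP[? ?] /andP[? ?] /andP[? ?] /andP[? ?] _].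
by move=> /mx2_inj[E1 E2 E3 E4]; congr (_, _, _, _); apply: decode_inj.
Qed.

Lemma decode0 : decode (0, 0)%N = 0.
Proof. by rewrite decodeE mul0r addr0. Qed.

Lemma det_upperc x : \det (decodemx (upperc x)) == 1.
Proof. by rewrite det_mx2 decode1 decode0 mulr0 subr0 mulr1. Qed.

Lemma det_lowerc x : \det (decodemx (lowerc x)) == 1.
Proof. by rewrite det_mx2 decode1 decode0 mul0r subr0 mulr1. Qed.

Lemma SL2c_upper x : SL2c (upperc x) = upper (decode x).
Proof.
by apply: val_inj; rewrite /= val_SL2c ?det_upperc //= decode1 decode0.
Qed.

Lemma SL2c_lower x : SL2c (lowerc x) = lower (decode x).
Proof.
by apply: val_inj; rewrite /= val_SL2c ?det_lowerc //= decode1 decode0.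
Qed.

Lemma SL2c1 : SL2c onec = 1%g.
Proof. by rewrite -[onec]/(upperc (0, 0)%N) SL2c_upper decode0 upper0. Qed.
Lemma reducedc_mulmxc M N : reducedc (mulmxc M N).
Proof.
by case: M N => [[[a b] c] d] [[[a' b'] c'] d']; rewrite /= !ltn_pmod.
Qed.
End Codes.

(** * Index at a prime power by certified enumeration of cosets *)

Lemma Gamma_mod_gen q : Gamma_mod q =
  <<[set upper (Zphi_proj q phiZ); lower (Zphi_proj q phiZ)]>>%g :> {set _}.
Proof.
apply/eqP; rewrite eqEsubset; apply/andP; split; last first.
  rewrite gen_subG; apply/subsetP => x /set2P[]->; 
    rewrite -?reduce_upper -?reduce_lower.
    by rewrite -matA_upper; apply: mem_image_mod Gamma_A.
  by rewrite -matB_lower; apply: mem_image_mod Gamma_B.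
set X := [set _; _]; apply/subsetP => _ /image_modP[g gG <-].
apply: (@Gamma_min [pred g | reduce q g \in <<X>>%g]) gG.
- split=> [|x y]; rewrite !inE; first by rewrite reduce1 group1.
  by move=> xX yX; rewrite reduceM reduceV groupM ?groupV.
- by rewrite inE matA_upper reduce_upper mem_gen // !inE eqxx.
- by rewrite inE matB_lower reduce_lower mem_gen // !inE eqxx orbT.
Qed.

Lemma SL2mod_gen p e : prime p ->
  <<[set upper (1 : Zphi_mod (p ^ e.+1)); upper (Zphi_proj _ phiZ);
         lower 1; lower (Zphi_proj _ phiZ)]>>%g = [set: SL2mod (p ^ e.+1)].
Proof.
move=> pp; set X := [set _; _; _; _]; apply/setP => g; rewrite [RHS]inE.
have XP x : x \in X -> x \in <<X>>%g by exact: mem_gen.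
apply: (@SL2mod_elementary p e <<X>>%G pp) => x;
    have [a [b ->]] := Zphi_modP x; rewrite rmorphD (rmorphM _ b%:~R) !rmorph_int.
  rewrite -[a%:~R]mul1r [_ * Zphi_proj _ _]mulrC upperD.
  by rewrite groupM ?group_upperMz ?XP // !inE eqxx ?orbT.
rewrite -[a%:~R]mul1r [_ * Zphi_proj _ _]mulrC lowerD.
by rewrite groupM ?group_lowerMz ?XP // !inE eqxx ?orbT.
Qed.

Definition gens4c : seq mx_code :=
  [:: upperc (1, 0)%N; upperc (0, 1)%N; lowerc (1, 0)%N; lowerc (0, 1)%N].

(** A certificate: [L] contains the identity and is stable under the generators of Gamma; the
    representatives have genuine inverses and lie in distinct cosets; the union of these cosets is
    stable under generators of the full group, which is thus never enumerated. *)
Definition coset_check (n : nat) (L s : seq mx_code) : bool :=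
  [&& all (reducedc n) L,
      all (fun M => all (fun g => mulmxc n M g \in L) gensc) L,
      onec \in L, onec \in s,
      all (fun M => [&& det1c n M, det1c n (invmxc n M) &
                        mulmxc n M (invmxc n M) == onec]) s,
      all (fun M => all (fun N => (M == N) ||
             (mulmxc n M (invmxc n N) \notin L)) s) s &
      all (fun M => all (fun g => has (fun N =>
             mulmxc n (mulmxc n M g) (invmxc n N) \in L) s) gens4c) s].

Section Index.
Variables (p e : nat).
Hypothesis pp : prime p.
Local Notation n := (p ^ e.+1)%N.
Local Notation K := (Gamma_mod n).

Let n0 : (0 < n)%N. Proof. by rewrite expn_gt0 prime_gt0. Qed.

(** The determinant condition keeps out codes that [SL2c] would send to its default 1, an element of
    [K]. *)
Let inK (M : mx_code) : bool := (\det (decodemx n M) == 1) && (SL2c n M \in K).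

Lemma inK_mul M N : inK M -> inK N -> inK (mulmxc n M N).
Proof.
move=> /andP[dM KM] /andP[dN KN]; rewrite /inK det_decodemxM //.
by rewrite SL2cM // groupM.
Qed.

Lemma inK_gens M : M \in gensc -> inK M.
Proof.
have d01 : decode n (0, 1)%N = Zphi_proj n phiZ by rewrite decodeE add0r mul1r.
rewrite !inE => /orP[]/eqP->; rewrite /inK ?SL2c_upper ?SL2c_lower ?d01 Gamma_mod_gen.
  by rewrite det_upperc mem_gen // !inE eqxx.
by rewrite det_lowerc mem_gen // !inE eqxx orbT.
Qed.

Lemma inK_closurec gens k L F :
  all inK gens -> all inK L -> all inK F -> all inK (closurec n gens k L F).
Proof.
move=> GK; elim: k L F => //= k IH L F LK FK; set N := undup _.
have NK : all inK N.
  apply/allP => M; rewrite mem_undup mem_filter => /andP[_].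
  move=> /flattenP[_ /mapP[A AF ->] /mapP[B BG ->]].
  by apply: inK_mul; [exact: (allP FK) | exact: (allP GK)].
by apply: IH => //; rewrite all_cat LK.
Qed.

(** The search produces only elements of [K], and stability under its generators makes [L] exhaust
    [K]; membership in [K] thus becomes membership in a list. *)
Lemma index_Gamma_mod k (L s : seq mx_code) :
  L = closurec n gensc k [:: onec] [:: onec] -> uniq s -> coset_check n L s ->
  #|G_mod n : Gamma_mod n|%g = size s.
Proof.
move=> LE us /and5P[Lred Lcl L1 s1 /and3P[sdet sdisj scov]].
have onecK : inK onec by rewrite /inK SL2c1 group1 (det_upperc _ (0, 0)%N).
have LK : all inK L by rewrite LE inK_closurec /= ?onecK ?inK_gens.
have KL x : x \in K -> exists2 M, M \in L & x = SL2c n M.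
  pose X := [set x in map (SL2c n) L].
  suff /subsetP XK : K \subset X by move=> /XK; rewrite inE => /mapP.
  rewrite Gamma_mod_gen; apply: gen_subset_stable.
    by rewrite inE; apply/mapP; exists onec; rewrite ?SL2c1.
  move=> y g; rewrite inE => /mapP[M ML ->] gX.
  have [N NG ->] : exists2 N, N \in gensc & g = SL2c n N.
    case/set2P: gX => ->; [exists (upperc (0, 1)%N) | exists (lowerc (0, 1)%N)] => //;
      by rewrite ?SL2c_upper ?SL2c_lower decodeE add0r mul1r.
  have /andP[dM _] := allP LK M ML; have /andP[dN _] := inK_gens NG.
  rewrite inE -SL2cM //; apply: map_f; exact: (allP (allP Lcl M ML)).
have sd M : M \in s -> \det (decodemx n M) == 1.
  by move=> /(allP sdet)/and3P[dM _ _]; exact: det_decodemx.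
have sdV M : M \in s -> \det (decodemx n (invmxc n M)) == 1.
  by move=> /(allP sdet)/and3P[_ dM _]; exact: det_decodemx.
have sV M : M \in s -> SL2c n (invmxc n M) = (SL2c n M)^-1%g.
  move=> Ms; have /and3P[_ _ /eqP E] := allP sdet M Ms.
  by apply: (mulgI (SL2c n M)); rewrite -SL2cM ?sdV ?sd // E SL2c1 mulgV.
have inL M : reducedc n M -> \det (decodemx n M) == 1 -> SL2c n M \in K -> M \in L.
  move=> rM dM /KL[N NL E]; have /andP[dN _] := allP LK N NL.
  by rewrite (SL2c_inj n0 rM (allP Lred N NL) dM dN E).
have Gfull x : x \in G_mod n.
  apply: (@SL2mod_elementary p e (G_mod n) pp) => z; rewrite -(Zphi_proj_repr z).
    by rewrite -reduce_upper; exact: mem_image_mod.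
  by rewrite -reduce_lower; exact: mem_image_mod.
apply: (index_reps (r := SL2c n)) => //.
- by apply/subsetP.
- move=> M N Ms Ns; rewrite -sV // -SL2cM ?sdV ?sd // => MN.
  apply/eqP; have /orP[//|] := allP (allP sdisj M Ms) N Ns; rewrite inL //.
    exact: reducedc_mulmxc.
  by rewrite det_decodemxM ?sdV ?sd.
move=> x _.
pose X := [set x | [exists M : seq_sub s, (x * (SL2c n (val M))^-1 \in K)%g]].
have XP y : reflect (exists2 M, M \in s & y * (SL2c n M)^-1 \in K)%g (y \in X).
  rewrite inE; apply: (iffP existsP) => [[[M Ms] yM]|[M Ms yM]]; first by exists M.
  by exists (SeqSub Ms).
apply/XP; have : x \in [set: SL2mod n] by rewrite inE.
rewrite -(SL2mod_gen e pp); apply: subsetP; apply: gen_subset_stable.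
  by apply/XP; exists onec => //; rewrite SL2c1 invg1 mulg1 group1.
move=> y g /XP[M Ms yM] gX; apply/XP.
have [N [NG dN ->]] : exists N, [/\ N \in gens4c, \det (decodemx n N) == 1 & g = SL2c n N].
  move: gX; rewrite !inE -!orbA => /or4P[] /eqP->;
    [exists (upperc (1, 0)%N) | exists (upperc (0, 1)%N) |
     exists (lowerc (1, 0)%N) | exists (lowerc (0, 1)%N)]; split=> //;
    by rewrite ?det_upperc ?det_lowerc // ?SL2c_upper ?SL2c_lower decodeE
      /= ?mul0r ?add0r ?mul1r ?addr0.
have /hasP[M' Ms' ML] := allP (allP scov M Ms) N NG; exists M' => //.
have /andP[_] := allP LK _ ML.
rewrite !SL2cM ?det_decodemxM ?dN ?sdV ?sd // sV // => E.
by have := groupM yM E; rewrite !mulgA mulgKV.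
Qed.
End Index.

(* Right coset representatives, found by computer search. *)
Definition reps3 : seq mx_code :=
  [:: ((1, 0), (0, 0), (0, 0), (1, 0));
     ((1, 0), (1, 0), (0, 0), (1, 0));
     ((1, 0), (0, 0), (1, 0), (1, 0));
     ((1, 0), (2, 0), (0, 0), (1, 0));
     ((2, 0), (1, 0), (1, 0), (1, 0));
     ((1, 0), (0, 0), (2, 0), (1, 0))]%N.

Definition reps4 : seq mx_code :=
  [:: ((1, 0), (0, 0), (0, 0), (1, 0));
     ((1, 0), (1, 0), (0, 0), (1, 0));
     ((1, 0), (0, 0), (1, 0), (1, 0));
     ((1, 0), (2, 0), (0, 0), (1, 0));
     ((2, 0), (1, 0), (1, 0), (1, 0));
     ((1, 1), (1, 0), (0, 1), (1, 0));
     ((1, 0), (1, 0), (1, 0), (2, 0));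
     ((1, 0), (0, 1), (1, 0), (1, 1));
     ((2, 1), (1, 0), (1, 1), (1, 0));
     ((1, 1), (2, 1), (0, 1), (1, 1));
     ((1, 0), (1, 1), (1, 0), (2, 1));
     ((1, 1), (0, 1), (2, 1), (1, 1))]%N.

Lemma index3 : #|G_mod 3 : Gamma_mod 3|%g = 6.
Proof.
rewrite -[6%N]/(size reps3).
(* The modulus is [3 ^ 0.+1], and 12 bounds the rounds of the search. *)
by apply: (@index_Gamma_mod 3 0 isT 12 _ reps3 erefl); vm_compute.
Qed.

Lemma index4 : #|G_mod 4 : Gamma_mod 4|%g = 12.
Proof.
rewrite -[12%N]/(size reps4).
by apply: (@index_Gamma_mod 2 1 isT 14 _ reps4 erefl); vm_compute.
Qed.

(** As 3 and 4 are coprime, the orders of both groups multiply, hence so do the indices 6 and 12. *)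
Lemma index12 : Gamma_mod 12 \subset G_mod 12 /\ #|G_mod 12 : Gamma_mod 12|%g = 72.
Proof.
have sub q : Gamma_mod q \subset G_mod q.
  by apply/subsetP => x /image_modP[g _ <-]; apply: mem_image_mod.
split; first exact: sub.
have LG := card_image_mod_coprime (m := 3) (n := 4) fullG_group_closed isT isT isT
  fullG_isolates34.
have LK := card_image_mod_coprime (m := 3) (n := 4) Gamma_group_closed isT isT isT
  (Gamma_isolates (m := 3) (n := 4) isT isT isT).
have E3 := Lagrange (sub 3); have E4 := Lagrange (sub 4); have E12 := Lagrange (sub 12).
rewrite index3 in E3; rewrite index4 in E4.
have {}LG : #|G_mod 12| = (#|G_mod 3| * #|G_mod 4|)%N := LG.
have {}LK : #|Gamma_mod 12| = (#|Gamma_mod 3| * #|Gamma_mod 4|)%N := LK.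
have K0 : (0 < #|Gamma_mod 12|)%N := cardG_gt0 _.
apply/eqP; rewrite -(eqn_pmul2l K0) E12 LG LK -E3 -E4; apply/eqP; ring.
Qed.

Local Close Scope ring_scope.

Theorem theorem3p1 (q : nat) (hq : 0 < q) :
  [/\ exists f : SL2mod q -> SL2prod q,
        (forall (g : SL2 Zphi) (p : seq_sub (primes q)),
           f (reduce q g) p = reduce (ppart p) g)
        /\ misom (Gamma_mod q) (Gamma_prod q) f,
      image_mod q (Gamma_ker (gcdn q 12)) = image_mod q (G_ker (gcdn q 12)) &
      Gamma_mod 12 \subset G_mod 12 /\ #|G_mod 12 : Gamma_mod 12|%g = 72].
Proof. by split; [exact: Gamma_mod_prod | exact: image_mod_ker | exact: index12]. Qed.
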